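(* Let $q\in(1,2]$ and let $\mu,\nu$ be symmetric Borel probability measures on $\mathbb R$ with finite $(2+\delta)$-th absolute moments for some $\delta>0$. Let the cost function $c$ be given by $$c(x,y,x',y')=|(x-x')(y-y')|^q.$$ Then the diamond transport $\pi_{\rm dia}$ is a minimizer of $\pi\mapsto\iint c(x,y,x',y')\,\mathrm d\pi(x,y)\,\mathrm d\pi(x',y')$ over $\pi\in\Pi(\mu,\nu)$.
   Context: $\Pi(\mu,\nu)$ is the set of all probability measures on $\mathbb R^2$ with marginals $\mu,\nu$. A probability measure $\mu$ on $\mathbb R$ is symmetric if there exists $m\in\mathbb R$ with $\mu(A)=\mu(m-A)$ for all Borel sets $A$. $Q_\mu(t)=\inf\{x\in\mathbb R:\mu((-\infty,x])\ge t\}$ is the left quantile function. Let $D=\{(x,y)\in[0,1]^2:|y-1/2|+|x-1/2|=1/2\}$. The diamond copula $C_{\rm dia}$ is the cdf of the uniform distribution on $D$ (normalized arc length). The diamond transport $\pi_{\rm dia}\in\Pi(\mu,\nu)$ is the law of $(Q_\mu(U),Q_\nu(V))$ where $(U,V)$ has distribution $C_{\rm dia}$. *)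

(* Defs.v *)
From HB Require Import structures.
From mathcomp Require Import all_boot all_order all_algebra.
From mathcomp Require Import all_classical all_reals all_analysis.
From mathcomp Require Import measurable_realfun lra.

Set Implicit Arguments.
Unset Strict Implicit.
Unset Printing Implicit Defensive.

Import Order.TTheory GRing.Theory Num.Theory.
Import numFieldNormedType.Exports.

Local Open Scope classical_set_scope.
Local Open Scope ring_scope.

Definition coupling {R : realType} (mu nu : probability R R)
    (pi : probability (R * R)%type R) : Prop :=
  (forall A : set R, measurable A -> pi (A `*` setT) = mu A) /\
  (forall B : set R, measurable B -> pi (setT `*` B) = nu B).

Definition symmetric_prob {R : realType} (mu : probability R R) : Prop :=
  exists m : R, forall A : set R, measurable A ->
    mu A = mu [set m - x | x in A].

Definition finite_abs_moment {R : realType} (mu : probability R R) (p : R) :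
    Prop :=
  (\int[mu]_x (`|x| `^ p)%:E < +oo)%E.

(* [inf] is real-valued and equals 0 on sets that are empty or unbounded below.
   The value of [quantile mu t] is the genuine quantile for 0 < t < 1, hence
   almost surely under either marginal of [diamond_law]. *)
Definition quantile {R : realType} (mu : probability R R) (t : R) : R :=
  inf [set x : R | (t%:E <= mu `]-oo, x]%classic)%E].

Section quantile_measurable.
Context {R : realType} (mu : probability R R).

Let S (t : R) : set R := [set x : R | (t%:E <= mu `]-oo, x]%classic)%E].

Let idR : R -> R := idfun.

#[local] HB.instance Definition _ :=
  @isMeasurableFun.Build _ _ _ _ idR (@measurable_id _ _ setT).

Let F (x : R) : \bar R := mu `]-oo, x]%classic.

Let FE : F = cdf (idR : {RV mu >-> R}).
Proof.
by apply/funext => x; rewrite /cdf /distribution /pushforward preimage_id.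
Qed.

Let F_nd x y : x <= y -> (F x <= F y)%E.
Proof. by rewrite FE; exact: cdf_nondecreasing. Qed.

Let S_nonempty t : t < 1 -> S t !=set0.
Proof.
move=> t1; have := cvg_cdfy1 (idR : {RV mu >-> R}).
rewrite -FE => /(_ [set u | (t%:E < u)%E]) h.
have /h [M [_ HM]] : nbhs (1%E : \bar R) [set u | (t%:E < u)%E].
  by apply: open_ereal_gt'; rewrite lte_fin.
by exists (M + 1); apply/ltW/(HM (M + 1)); rewrite ltrDl.
Qed.

Let S_lbound t : 0 < t -> has_lbound (S t).
Proof.
move=> t0; have := cvg_cdfNy0 (idR : {RV mu >-> R}).
rewrite -FE => /(_ [set u | (u < t%:E)%E]) h.
have /h [M [_ HM]] : nbhs (0%E : \bar R) [set u | (u < t%:E)%E].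
  by apply: open_ereal_lt'; rewrite lte_fin.
exists (M - 1) => x /= Sx; rewrite leNgt; apply/negP => xM.
have /HM/= : x < M by rewrite (lt_trans xM)// ltrBlDr ltrDl.
by rewrite ltNge => /negP; apply; exact: Sx.
Qed.

Let quantile_le0 t : t <= 0 -> quantile mu t = 0.
Proof.
move=> t0; apply: inf_out => -[_ [M HM]].
have := HM (M - 1); rewrite lerBrDr gerDl ler10.
by move/(_ _)/negP; apply => //=; rewrite (le_trans _ (measure_ge0 _ _))// lee_fin.
Qed.

Let quantile_gt1 t : 1 < t -> quantile mu t = 0.
Proof.
move=> t1; apply: inf_out => -[[x /= Sx] _].
have := le_trans Sx (probability_le1 mu (measurable_itv _)).
by rewrite lee_fin leNgt t1.
Qed.

Let quantile_nd s t : 0 < s -> s <= t -> t < 1 -> quantile mu s <= quantile mu t.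
Proof.
move=> s0 st t1; apply: inf_le.
- move=> _ [x Sx <-]; exists (- x); split=> //; exists x => //=.
  by apply: le_trans Sx; rewrite lee_fin.
- exact: S_nonempty.
- by split; [exact/S_nonempty/(le_lt_trans st)|exact: S_lbound].
Qed.

Lemma measurable_quantile : measurable_fun [set: R] (quantile mu).
Proof.
have -> : [set: R] = `]-oo, 0]%classic `|` (`]0, 1[%classic `|`
    ([set 1] `|` `]1, +oo[%classic)).
  apply/seteqP; split => // x _ /=; rewrite !in_itv/= andbT.
  case: (leP x 0) => ?; [by left|right].
  by case: (ltgtP x 1) => ?; [left|right; right|right; left].
apply/measurable_funU => //; first by do 2 apply: measurableU => //.
split.
  apply: (eq_measurable_fun (cst (0 : R))); last exact: measurable_cst.
  by move=> x; rewrite inE/= in_itv/= => /quantile_le0 ->.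
apply/measurable_funU => //; first exact: measurableU.
split.
  apply: (measurability (@RGenCInfty.G R)) => [|/= _ [_] [r] -> <-].
    exact: RGenCInfty.measurableE.
  apply: is_interval_measurable => s t/=.
  rewrite !in_itv/= !andbT => -[/andP[s0 s1] rs] [/andP[t0 t1] rt] u.
  move=> /andP[su ut]; rewrite !in_itv/= andbT.
  have u0 := lt_le_trans s0 su; have u1 := le_lt_trans ut t1.
  by rewrite u0 u1; split => //; exact: le_trans rs (quantile_nd s0 su u1).
apply/measurable_funU => //; split; first exact: measurable_fun_set1.
apply: (eq_measurable_fun (cst (0 : R))); last exact: measurable_cst.
by move=> x; rewrite inE/= in_itv/= andbT => /quantile_gt1 ->.
Qed.

End quantile_measurable.

Definition diamond {R : realType} : set (R * R) :=
  [set z | 0 <= z.1 <= 1 /\ 0 <= z.2 <= 1 /\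
           `|z.2 - 2^-1| + `|z.1 - 2^-1| = 2^-1].

(* Runs through [diamond] once, at constant Euclidean speed, as s runs through
   [0, 1] (lemmas diamond_curve_range, diamond_curve_inj, diamond_curve_speed);
   the vertices (0, 1/2), (1/2, 1), (1, 1/2), (1/2, 0) are met at
   s = 0, 1/4, 1/2, 3/4. *)
Definition diamond_curve {R : realType} (s : measurableTypeR R) : R * R :=
  (1 - `|2 * s - 1|, `|2 * `|s - 4^-1| - 1|).

Section diamond_curve.
Context {R : realType}.
Implicit Types s t : R.

Let curveE s : 0 <= s <= 1 ->
  [\/ s <= 4^-1 /\ diamond_curve s = (2 * s, 2^-1 + 2 * s),
      4^-1 <= s <= 2^-1 /\ diamond_curve s = (2 * s, 3 / 2 - 2 * s),
      2^-1 <= s <= 3 / 4 /\ diamond_curve s = (2 - 2 * s, 3 / 2 - 2 * s) |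
      3 / 4 <= s /\ diamond_curve s = (2 - 2 * s, 2 * s - 3 / 2)].
Proof.
move=> /andP[s0 s1]; rewrite /diamond_curve.
have [s4|s4] := leP s 4^-1.
  apply: Or41; split=> //; rewrite (ler0_norm (_ : s - _ <= 0)); last lra.
  by rewrite !ler0_norm; [congr pair; lra| lra..].
rewrite (ger0_norm (_ : 0 <= s - _)); last lra.
have [s2|s2] := leP s 2^-1.
  apply: Or42; split; first by rewrite ltW.
  by rewrite !ler0_norm; [congr pair; lra| lra..].
rewrite (ger0_norm (_ : 0 <= 2 * s - 1)); last lra.
have [s3|s3] := leP s (3 / 4).
  apply: Or43; split; first by rewrite ltW.
  by rewrite !ler0_norm; [congr pair; lra| lra..].
apply: Or44; split; first exact: ltW.
by rewrite ger0_norm; [congr pair; lra| lra..].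
Qed.

Lemma diamond_curve_range : diamond_curve @` `[0, 1]%classic = @diamond R.
Proof.
apply/seteqP; split => [_ [s /= + <-]|[x y]/=].
  rewrite in_itv/= => s01; move: (s01) => /andP[s0 s1].
  have [[h ->]|[/andP[h h'] ->]|[/andP[h h'] ->]|[h ->]] := curveE s01;
    rewrite /diamond/=; do 2 (split; first by apply/andP; split; lra).
  - by rewrite ger0_norm ?ler0_norm; lra.
  - by rewrite !ger0_norm; lra.
  - by rewrite ler0_norm ?ger0_norm; lra.
  - by rewrite !ler0_norm; lra.
rewrite /diamond/= => -[/andP[x0 x1] [/andP[y0 y1]]].
pose P s := 0 <= s <= 1 /\ diamond_curve s = (x, y).
move=> h; suff [s [s01 sE]] : exists s, P s by exists s => //=; rewrite in_itv.
move: h.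
have [yh|yh] := leP 2^-1 y; have [xh|xh] := leP 2^-1 x.
- rewrite !ger0_norm; [|lra..] => h; exists (x / 2).
  have s01 : 0 <= x / 2 <= 1 by apply/andP; split; lra.
  split=> //; have [[? ->]|[/andP[? ?] ->]|[/andP[? ?] ->]|[? ->]] := curveE s01;
  by congr pair; lra.
- rewrite ger0_norm ?ler0_norm; [|lra..] => h; exists (x / 2).
  have s01 : 0 <= x / 2 <= 1 by apply/andP; split; lra.
  split=> //; have [[? ->]|[/andP[? ?] ->]|[/andP[? ?] ->]|[? ->]] := curveE s01;
  by congr pair; lra.
- rewrite ler0_norm ?ger0_norm; [|lra..] => h; exists (1 - x / 2).
  have s01 : 0 <= 1 - x / 2 <= 1 by apply/andP; split; lra.
  split=> //; have [[? ->]|[/andP[? ?] ->]|[/andP[? ?] ->]|[? ->]] := curveE s01;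
  by congr pair; lra.
- rewrite !ler0_norm; [|lra..] => h; exists (1 - x / 2).
  have s01 : 0 <= 1 - x / 2 <= 1 by apply/andP; split; lra.
  split=> //; have [[? ->]|[/andP[? ?] ->]|[/andP[? ?] ->]|[? ->]] := curveE s01;
  by congr pair; lra.
Qed.

Lemma diamond_curve_inj s t : 0 <= s < 1 -> 0 <= t < 1 ->
  diamond_curve s = diamond_curve t -> s = t.
Proof.
move=> /andP[s0 s1] /andP[t0 t1].
have s01 : 0 <= s <= 1 by rewrite s0 ltW.
have t01 : 0 <= t <= 1 by rewrite t0 ltW.
have [[? ->]|[/andP[? ?] ->]|[/andP[? ?] ->]|[? ->]] := curveE s01;
have [[? ->]|[/andP[? ?] ->]|[/andP[? ?] ->]|[? ->]] := curveE t01;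
by case=> ? ?; lra.
Qed.

(* The speed 2 * sqrt 2 is the total length of [diamond]. *)
Lemma diamond_curve_speed (k : nat) s t : (k < 4)%N ->
  k%:R / 4 <= s <= k.+1%:R / 4 -> k%:R / 4 <= t <= k.+1%:R / 4 ->
  Num.sqrt (((diamond_curve s).1 - (diamond_curve t).1) ^+ 2 +
            ((diamond_curve s).2 - (diamond_curve t).2) ^+ 2) =
  2 * Num.sqrt 2 * `|s - t|.
Proof.
move=> k4 /andP[s0 s1] /andP[t0 t1].
suff -> : ((diamond_curve s).1 - (diamond_curve t).1) ^+ 2 +
    ((diamond_curve s).2 - (diamond_curve t).2) ^+ 2 =
    2 ^+ 2 * 2 * (s - t) ^+ 2.
  rewrite sqrtrM; last by rewrite mulr_ge0 ?sqr_ge0.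
  by rewrite sqrtrM ?sqr_ge0// !sqrtr_sqr normr_nat.
have cE (u : R) : k%:R / 4 <= u <= k.+1%:R / 4 -> 0 <= u <= 1.
  by case: k k4 {s0 s1 t0 t1} => [|[|[|[|]]]]// _ /andP[? ?]; apply/andP; split; lra.
have s01 : 0 <= s <= 1 by apply: cE; rewrite s0.
have t01 : 0 <= t <= 1 by apply: cE; rewrite t0.
case: k k4 s0 s1 t0 t1 {cE} => [|[|[|[|]]]]// _ s0 s1 t0 t1;
have [[? ->]|[/andP[? ?] ->]|[/andP[? ?] ->]|[? ->]] := curveE s01;
have [[? ->]|[/andP[? ?] ->]|[/andP[? ?] ->]|[? ->]] := curveE t01 => /=; nra.
Qed.

Lemma measurable_diamond_curve :
  measurable_fun [set: measurableTypeR R] diamond_curve.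
Proof.
apply: measurable_fun_pair => /=.
  apply: measurable_funB => //; apply: measurableT_comp => //.
  by apply: measurable_funB => //; exact: measurable_funM.
apply: measurableT_comp => //; apply: measurable_funB => //.
apply: measurable_funM => //; apply: measurableT_comp => //.
exact: measurable_funB.
Qed.

HB.instance Definition _ :=
  @isMeasurableFun.Build _ _ _ _ diamond_curve measurable_diamond_curve.

End diamond_curve.

(* Normalized arc length on [diamond], i.e. the law of (U, V) whose cdf is the
   diamond copula. *)
Definition diamond_law (R : realType) : probability (R * R)%type R :=
  distribution (uniform_prob (@ltr01 R))
    diamond_curve.

Section diamond_transport.
Context {R : realType} (mu nu : probability R R).

Definition quantile_pair (u : R * R) : R * R :=
  (quantile mu u.1, quantile nu u.2).

Lemma measurable_quantile_pair :
  measurable_fun [set: (R * R)%type] quantile_pair.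
Proof.
apply: measurable_fun_pair => /=.
  exact: (measurableT_comp (measurable_quantile mu)).
exact: (measurableT_comp (measurable_quantile nu)).
Qed.

HB.instance Definition _ :=
  isMeasurableFun.Build _ _ (R * R)%type (R * R)%type quantile_pair
    measurable_quantile_pair.

Definition diamond_transport : probability (R * R)%type R :=
  distribution (diamond_law R) quantile_pair.

End diamond_transport.

Definition pair_cost {R : realType} (q x y x' y' : R) : R :=
  `|(x - x') * (y - y')| `^ q.

Definition quadratic_cost {R : realType} (q : R)
    (pi : probability (R * R)%type R) : \bar R :=
  (\int[pi]_z' \int[pi]_z (pair_cost q z.1 z.2 z'.1 z'.2)%:E)%E.

(* Main.v *)
Require Import Defs.
From HB Require Import structures.
From mathcomp Require Import all_boot all_order all_algebra.
From mathcomp Require Import all_classical all_reals all_analysis.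
From mathcomp Require Import measurable_realfun ring lra.
Import Order.TTheory GRing.Theory Num.Theory.
Import numFieldNormedType.Exports.
Set Implicit Arguments.
Unset Strict Implicit.
Unset Printing Implicit Defensive.
Local Open Scope classical_set_scope.
Local Open Scope ring_scope.

(** Centre both marginals at 0 and let (X, Y), (X', Y') be independent with the same
    law pi. Write k for the part of |x - x'|^q that is even in x and h for minus its odd
    part, so that |x - x'|^q = k - h; the even part is also even in x', and likewise for
    the odd one. The proof compares three numbers: the cost of pi, the mean of
    k(X, X') k(Y, Y') under pi, and the cost of the diamond transport.

    Symmetrization (symmetrization_le). The cost of pi is at least the mean of
    k(X, X') k(Y, Y'). For 0 < q < 2, |x|^q is a positive multiple of the integral of
    (1 - cos (t x)) t^(-1-q) over t > 0. Hence h is a Gram kernel, with features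
    sin (t x), and so is d = |x|^q + |x'|^q - k, with features 1 - cos (t x). The
    exponent 2 is a degenerate case of the same picture. Products of Gram kernels are
    Gram kernels, so h h, d h and h d have nonnegative means (gram_integral_ge0,
    kernel_product_integral_ge0). The difference between the cost and k k is the sum of
    these three terms and of terms that are odd in a single variable, whose means vanish
    because the marginals are symmetric.

    Rearrangement (antimonotone_minimal). As q >= 1, k(x, a) is even and nondecreasing
    in |x|. For fixed (a, b) the mean of k(X, a) k(Y, b) is therefore smallest when |X|
    and |Y| are countermonotone (countermonotone_minimal, by cutting both factors into
    layers). The mean of k(X, X') k(Y, Y') is bilinear in the laws of the two points, so
    this applies to each of them in turn.

    Equality. Under the diamond transport X and Y have independent fair signs, and |X|
    and |Y| are countermonotone (diamond_integral). Averaging over the signs turns its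
    cost into the mean of k(X, X') k(Y, Y'), and countermonotonicity makes this mean
    equal to the lower bound found by rearrangement (quadratic_cost_diamond). *)

(** * Affine changes of variable for Lebesgue measure *)

Lemma measurableT_comp2 d0 d1 d2 d3 (T : measurableType d0)
    (T1 : measurableType d1) (T2 : measurableType d2) (T3 : measurableType d3)
    (h : T1 -> T2 -> T3) (u : T -> T1) (v : T -> T2) :
  measurable_fun setT (fun p => h p.1 p.2) ->
  measurable_fun setT u -> measurable_fun setT v ->
  measurable_fun setT (fun x => h (u x) (v x)).
Proof.
move=> mh mu mv.
exact: (measurableT_comp mh (measurable_fun_pair mu mv)).
Qed.

Section affine.
Context {R : realType}.
Local Notation mu := (@lebesgue_measure R).

Lemma measurable_affine (a b : R) :
  measurable_fun [set: measurableTypeR R]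
    ((fun t => a * t + b) : measurableTypeR R -> measurableTypeR R).
Proof.
apply: measurable_funD; last exact: measurable_cst.
by apply: measurable_funM => //; exact: measurable_cst.
Qed.

Lemma lebesgue_measure_scale (a b : R) (A : set (measurableTypeR R)) :
  0 < a -> measurable A ->
  mu ((fun t => a * t + b) @^-1` A) = (a^-1%:E * mu A)%E.
Proof.
move=> a0 mA.
set phi := (fun t : measurableTypeR R => a * t + b : measurableTypeR R).
have mphi : measurable_fun setT phi := measurable_affine a b.
have E : mu A = (a%:E * mu (phi @^-1` A))%E.
  have c0 := ltW a0.
  apply: (@lebesgue_measure_unique R (mscale (NngNum c0) (pushforward mu phi)))
    => // _ [[c d]] _ <-.
  rewrite -[RHS]/(a%:E * mu (phi @^-1` `]c, d]))%E.
  rewrite (_ : (phi @^-1` _) = `](c - b) / a, (d - b) / a]%classic); last first.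
    apply/seteqP; rewrite /phi; split => x /=; rewrite !in_itv/=;
    rewrite ltr_pdivrMr// ler_pdivlMr// (mulrC x) => /andP[? ?];
    by apply/andP; split; lra.
  rewrite !lebesgue_measure_itv/= !lte_fin.
  rewrite ltr_pM2r ?invr_gt0// ltrD2r.
  by case: ifP => _; rewrite ?mule0// -!EFinB -EFinM; congr EFin; field; lra.
by rewrite E muleA -EFinM mulVf ?gt_eqF// mul1e.
Qed.

(** Negative slopes reduce to positive ones by reflection; for a positive slope, the
    rescaled image of Lebesgue measure agrees with it on half-open intervals. *)
Lemma ge0_integral_affine (a b : R) (f : R -> \bar R) :
  a != 0 -> measurable_fun setT f -> (forall t, (0 <= f t)%E) ->
  (\int[mu]_t f (a * t + b)%R = (`|a|^-1)%:E * \int[mu]_t f t)%E.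
Proof.
wlog a0 : a b f / 0 < a => [H|].
  rewrite neq_lt => /orP[a0|a0] mf f0; last by apply: H => //; rewrite gt_eqF.
  pose g (t : measurableTypeR R) := f (- t).
  have mg : measurable_fun setT g by apply: measurableT_comp => //; exact: oppr_measurable.
  have -> : (\int[mu]_t f (a * t + b)%R = \int[mu]_t g ((- a) * t + (- b))%R)%E.
    by apply: eq_integral => t _; rewrite /g; congr f; ring.
  rewrite H ?oppr_gt0// ?oppr_eq0 ?lt_eqF//; last by move=> t; exact: f0.
  rewrite normrN; congr (_ * _)%E.
  transitivity (\int[pushforward mu (-%R : _ -> measurableTypeR R)]_t f t)%E.
    rewrite ge0_integral_pushforward ?preimage_setT//.
  by apply: eq_measure_integral => A mA _; exact: lebesgue_measureN.
move=> _ mf f0.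
have mphi := measurable_affine a b.
transitivity (\int[pushforward mu
    (fun t : measurableTypeR R => (a * t + b)%R : measurableTypeR R)]_t f t)%E.
  by rewrite ge0_integral_pushforward ?preimage_setT.
rewrite gtr0_norm//.
have c0 : 0 <= a^-1 by rewrite invr_ge0 ltW.
transitivity (\int[mscale (NngNum c0) mu]_t f t)%E; last first.
  by rewrite ge0_integral_mscale.
by apply: eq_measure_integral => A mA _; exact: lebesgue_measure_scale.
Qed.
End affine.

(** * The integral of (1 - cos (t x)) t^(-1-q) *)

Section cosint.
Context {R : realType}.
Local Notation mu := (@lebesgue_measure R).
Implicit Types (q t x c d a : R).

Lemma integral_powR_itv c d a : 0 < c -> c < d -> a + 1 != 0 ->
  (\int[mu]_(t in `[c, d]) (t `^ a)%:E
   = ((d `^ (a + 1) - c `^ (a + 1)) / (a + 1))%:E)%E.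
Proof.
move=> c0 cd a1.
pose F t := (a + 1)^-1 * t `^ (a + 1).
have dF t : 0 < t -> is_derive t 1 F (t `^ a).
  move=> t0; have := @is_deriveZ _ _ _ (fun t => t `^ (a + 1)) (a + 1)^-1 t 1 _
    (is_derive1_powR (a + 1) t0).
  by rewrite /GRing.scale/= mulrA mulVf// mul1r addrK.
have cF t : 0 < t -> {for t, continuous F}.
  move=> t0; apply: differentiable_continuous; apply/derivable1_diffP.
  by have [] := dF _ t0.
rewrite (@continuous_FTC2 _ (fun t => t `^ a) F)//.
- by rewrite -EFinB /F; congr EFin; ring.
- apply: derivable_within_continuous => t; rewrite in_itv/= => /andP[ct _].
  by apply: derivable_powR; rewrite in_itv/= andbT (lt_le_trans c0).
- split.
  + move=> t; rewrite in_itv/= => /andP[ct _].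
    by have [] := dF _ (lt_trans c0 ct).
  + by apply: cvg_at_right_filter; exact: cF.
  + by apply: cvg_at_left_filter; apply: cF; exact: lt_trans cd.
- move=> t; rewrite in_itv/= => /andP[ct _].
  by rewrite derive1E; have [_ ->] := dF _ (lt_trans c0 ct).
Qed.

Lemma sin_le_id t : 0 <= t -> `|sin t| <= t.
Proof.
move=> t0.
have [c _] : exists2 c, c \in `[0, t]%R & sin t - sin 0 = cos c * (t - 0).
  apply: MVT_segment => //; apply: derivable_within_continuous => x _.
  exact: derivable_sin.
rewrite sin0 !subr0 => ->; rewrite normrM (ger0_norm t0).
by rewrite ler_piMl// cos_max.
Qed.

Lemma one_sub_cos_le t : 0 <= t -> 1 - cos t <= t ^+ 2.
Proof.
move=> t0; have t20 : 0 <= t / 2 by rewrite divr_ge0.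
rewrite (_ : cos t = cos ((t / 2) *+ 2)); last by congr cos; lra.
rewrite cos_mulr2n cos2sin2 -(real_normK (num_real (sin _))).
have := sin_le_id t20; have := normr_ge0 (sin (t / 2)).
by nra.
Qed.

(** The Levy density of the symmetric q-stable law, restricted to the half-line;
    carried by a function on the whole line so that affine substitutions need no
    care about the domain. *)
Definition levy_density q t : R := if 0 < t then t `^ (- (1 + q)) else 0.

Lemma levy_density_ge0 q t : 0 <= levy_density q t.
Proof. by rewrite /levy_density; case: ifP => // _; exact: powR_ge0. Qed.

Lemma measurable_levy_density q : measurable_fun setT (levy_density q).
Proof.
apply: measurable_fun_ifT => //; exact: measurable_fun_ltr.
Qed.

Definition coswave q t x := levy_density q t * (1 - cos (t * x)).

Lemma coswave_ge0 q t x : 0 <= coswave q t x.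
Proof. by rewrite mulr_ge0 ?levy_density_ge0// subr_ge0 cos_le1. Qed.

Lemma measurable_coswave q x : measurable_fun setT (coswave q ^~ x).
Proof.
apply: measurable_funM; first exact: measurable_levy_density.
apply: measurable_funB => //; apply: measurableT_comp.
  by apply: continuous_measurable_fun => ?; exact: continuous_cos.
exact: measurable_funM.
Qed.

(** Substituting x t for t turns cos (t x) into cos t and extracts x^q from the
    homogeneous density. *)
Lemma coswave_scale q x : 0 < x ->
  (\int[mu]_t (coswave q t x)%:E = (x `^ q)%:E * \int[mu]_t (coswave q t 1)%:E)%E.
Proof.
move=> x0.
have E t : coswave q (x * t + 0) 1 = x `^ (- (1 + q)) * coswave q t x.
  rewrite /coswave /levy_density addr0 mulr1 pmulr_rgt0// (mulrC x).
  case: ifP => t0; last by rewrite !mul0r mulr0.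
  by rewrite powRM ?ltW//; ring.
have m1 : measurable_fun [set: R] (fun t => (coswave q t 1)%:E).
  by apply/measurable_EFinP; exact: measurable_coswave.
have c0 t : (0 <= (coswave q t 1)%:E)%E by rewrite lee_fin coswave_ge0.
have xn0 : x != 0 by rewrite gt_eqF.
have := ge0_integral_affine 0 xn0 m1 c0.
under eq_integral do rewrite E EFinM.
rewrite ge0_integralZl//; last 3 first.
- by apply/measurable_EFinP; exact: measurable_coswave.
- by move=> t _; rewrite lee_fin coswave_ge0.
- by rewrite lee_fin powR_ge0.
move=> /(congr1 (fun y => ((x `^ (1 + q))%:E * y)%E)).
rewrite !muleA -!EFinM -powRD ?xn0 ?implybT// subrr powRr0 mul1e => ->.
rewrite gtr0_norm// powRD ?xn0 ?implybT// powRr1 ?ltW//.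
by rewrite mulrAC mulfV// mul1r.
Qed.

(** Near 0 the integrand is at most t^(1-q), as 1 - cos t <= t^2, and this is
    integrable because q < 2; near infinity it is at most 2 t^(-1-q). *)
Lemma coswave_lty q : 0 < q < 2 -> (\int[mu]_t (coswave q t 1)%:E < +oo)%E.
Proof.
move=> /andP[q0 q2].
(* n.+2 rather than n.+1, so that 1 is always an interior point *)
pose E (n : nat) : set R := `[n.+2%:R^-1, n.+2%:R]%classic.
have mE n : measurable (E n) by exact: measurable_itv.
have mf n : measurable_fun (E n) (fun t => (coswave q t 1)%:E).
  by apply/measurable_EFinP/measurable_funTS; exact: measurable_coswave.
have ndE : nondecreasing_seq E.
  move=> m n mn; apply/subsetPset; apply: subset_itv; rewrite bnd_simp.
    by rewrite lef_pV2 ?posrE// ler_nat.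
  by rewrite ler_nat.
have UE : \bigcup_n E n = `]0, +oo[%classic :> set R.
  apply/seteqP; split => t /=.
    move=> [n _]; rewrite /E/= !in_itv/= andbT => /andP[+ _].
    by apply: lt_le_trans; rewrite invr_gt0.
  rewrite in_itv/= andbT => t0.
  exists (Num.truncn (Num.max t t^-1)) => //; rewrite /E/= in_itv/=.
  have := truncnS_gt (Num.max t t^-1); rewrite gt_max => /andP[h1 h2].
  set m := Num.truncn _ in h1 h2 *.
  have hm : m.+1%:R <= m.+2%:R :> R by rewrite ler_nat.
  rewrite (le_trans (ltW h1) hm) andbT -[leRHS]invrK lef_pV2 ?posrE ?invr_gt0//.
  exact: le_trans (ltW h2) hm.
have -> : (\int[mu]_t (coswave q t 1)%:E =
    \int[mu]_(t in \bigcup_n E n) (coswave q t 1)%:E)%E.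
  rewrite UE [RHS]integral_mkcond; apply: eq_integral => t _.
  rewrite patchE; case: ifPn => //.
  rewrite notin_setE/= in_itv/= andbT => /negP h.
  by rewrite /coswave /levy_density (negbTE h) mul0r.
apply: (@le_lt_trans _ _ ((2 - q)^-1 + 2 / q)%:E); last exact: ltry.
have f0 n t : E n t -> (0 <= (coswave q t 1)%:E)%E.
  by move=> _; rewrite lee_fin coswave_ge0.
have h := @ge0_nondecreasing_set_cvg_integral _ (measurableTypeR R) R E _ mu
  ndE mE mf f0.
apply: (cvge_to_le h); apply: nearW => n.
have n1 : (1 : R) < n.+2%:R by rewrite ltr1n.
have n0 : (0 : R) < n.+2%:R^-1 by rewrite invr_gt0.
have n1' : n.+2%:R^-1 < 1 :> R by rewrite invf_lt1.
pose E1 : set R := `[n.+2%:R^-1, 1]%classic; pose E2 : set R := `[1, n.+2%:R]%classic.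
have mE1 : measurable E1 by exact: measurable_itv.
have mE2 : measurable E2 by exact: measurable_itv.
have le1 : (\int[mu]_(t in E1) (coswave q t 1)%:E <= ((2 - q)^-1)%:E)%E.
  apply: (@le_trans _ _ (\int[mu]_(t in E1) (t `^ (1 - q))%:E)%E).
    apply: ge0_le_integral => //.
    - by move=> t _; rewrite lee_fin coswave_ge0.
    - by apply/measurable_EFinP/measurable_funTS; exact: measurable_coswave.
    - by apply/measurable_EFinP/measurable_funTS; exact: measurable_powR.
    - move=> t; rewrite /E1/= in_itv/= => /andP[nt t1].
      have t0 : 0 < t := lt_le_trans n0 nt.
      rewrite lee_fin /coswave /levy_density t0 mulr1.
      rewrite (_ : 1 - q = - (1 + q) + 2); last by ring.
      rewrite powRD; last by apply/implyP => _; rewrite gt_eqF.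
      rewrite ler_wpM2l ?powR_ge0//.
      by rewrite (powR_mulrn 2) ?one_sub_cos_le// ltW.
  rewrite integral_powR_itv//; last by rewrite gt_eqF//; lra.
  rewrite lee_fin powR1 (_ : 1 - q + 1 = 2 - q); last by ring.
  have q20 : 0 <= (2 - q)^-1 by rewrite invr_ge0; lra.
  by rewrite -[leRHS]mul1r ler_wpM2r// lerBlDr lerDl powR_ge0.
have le2 : (\int[mu]_(t in E2) (coswave q t 1)%:E <= (2 / q)%:E)%E.
  apply: (@le_trans _ _ (\int[mu]_(t in E2) (2%:E * (t `^ (- (1 + q)))%:E))%E).
    apply: ge0_le_integral => //.
    - by move=> t _; rewrite lee_fin coswave_ge0.
    - by apply/measurable_EFinP/measurable_funTS; exact: measurable_coswave.
    - apply: measurable_funeM.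
      by apply/measurable_EFinP/measurable_funTS; exact: measurable_powR.
    - move=> t; rewrite /E2/= in_itv/= => /andP[t1 _].
      have t0 : 0 < t := lt_le_trans ltr01 t1.
      rewrite -EFinM lee_fin /coswave /levy_density t0 mulrC ler_wpM2r ?powR_ge0//.
      by have := cos_geN1 (t * 1); lra.
  rewrite ge0_integralZl//; last 2 first.
  - by apply/measurable_EFinP/measurable_funTS; exact: measurable_powR.
  - by move=> t _; rewrite lee_fin powR_ge0.
  rewrite integral_powR_itv//; last by rewrite lt_eqF//; lra.
  rewrite -EFinM lee_fin powR1 ler_wpM2l//.
  rewrite (_ : - (1 + q) + 1 = - q); last by ring.
  have qV0 : 0 <= q^-1 by rewrite invr_ge0 ltW.
  by rewrite invrN mulrN -mulNr opprB -[leRHS]mul1r ler_wpM2r//.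
rewrite EFinD; apply: le_trans (leeD le1 le2).
have -> : E n = E1 `|` (`]1, n.+2%:R]%classic).
  apply/seteqP; rewrite /E /E1; split => t /=; rewrite !in_itv/=.
    by move=> /andP[-> ->]; rewrite andbT; case: (leP t 1) => t1; [left|right].
  case=> /andP[h1 h2]; first by rewrite h1 (le_trans h2 (ltW n1)).
  by rewrite h2 andbT (ltW (lt_trans n1' h1)).
have mc A : measurable_fun A (fun t => (coswave q t 1)%:E).
  by apply/measurable_EFinP/measurable_funTS; exact: measurable_coswave.
rewrite ge0_integral_setU//; last 3 first.
- exact: mc.
- by move=> t _; rewrite lee_fin coswave_ge0.
- apply/disj_setPRL => t; rewrite /E1/= !in_itv/= => /andP[t1 _] /andP[_].
  by rewrite leNgt t1.
apply: leeD => //; apply: ge0_subset_integral => //.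
- exact: mc.
- by move=> t _; rewrite lee_fin coswave_ge0.
- by move=> t; rewrite /E2/= !in_itv/= => /andP[/ltW -> ->].

Qed.

Lemma coswave_gt0 q : 0 < q -> (0 < \int[mu]_t (coswave q t 1)%:E)%E.
Proof.
move=> q0.
have mc : measurable_fun [set: R] (fun t => (coswave q t 1)%:E).
  by apply/measurable_EFinP; exact: measurable_coswave.
have inpi t : 0 <= t <= 2 -> t \in `[0, pi]%R.
  by move=> /andP[t0 t2]; rewrite in_itv/= t0 (le_trans t2)// pi_ge2.
pose c : R := 2 `^ (- (1 + q)) * (1 - cos 1).
have c0 : 0 < c.
  rewrite mulr_gt0 ?powR_gt0// subr_gt0 -{2}cos0 ltr_cos//.
    by apply: inpi; lra.
  by apply: inpi; lra.
apply: (@lt_le_trans _ _ (\int[mu]_(t in `[1%R, 2%R]) (c%:E))%E).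
  have -> : (\int[mu]_(t in `[1%R, 2%R]) c%:E = c%:E * mu `[1%R, 2%R]%classic)%E.
    exact: integral_cst.
  rewrite lebesgue_measure_itv/= lte_fin ltr1n/= -EFinB.
  by rewrite -EFinM lte_fin mulr_gt0//; lra.
apply: (@le_trans _ _ (\int[mu]_(t in `[1%R, 2%R]) (coswave q t 1)%:E)%E).
  apply: ge0_le_integral => //.
  - by move=> t _; rewrite lee_fin ltW.
  - exact: measurable_funTS.
  - move=> t; rewrite /= in_itv/= => /andP[t1 t2].
    have t0 : 0 < t := lt_le_trans ltr01 t1.
    rewrite lee_fin /coswave /levy_density t0 mulr1 ler_pM ?powR_ge0//.
    + rewrite !powRN lef_pV2 ?posrE ?powR_gt0//.
      by apply: ge0_ler_powR; rewrite ?nnegrE//; lra.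
    + rewrite lerD2l lerN2; move: t1; rewrite le_eqVlt => /predU1P[<-//|t1].
      by apply/ltW; rewrite ltr_cos//; apply: inpi; lra.
apply: ge0_subset_integral => // t _.
by rewrite lee_fin coswave_ge0.
Qed.

End cosint.

(** * Integrable functions together with their integral *)

Section has_integral.
Context d (T : measurableType d) (R : realType).
Variable mu : {measure set T -> \bar R}.
Implicit Types (f g : T -> R) (v w a : R).

(** Bundling integrability with a finite value lets linear combinations of integrals
    be computed without tracking infinite values. *)
Definition has_integral f v :=
  mu.-integrable setT (EFin \o f) /\ (\int[mu]_x (f x)%:E = v%:E)%E.

Lemma has_integralD f g v w : has_integral f v -> has_integral g w ->
  has_integral (fun x => f x + g x) (v + w).
Proof.
move=> [fi fv] [gi gw]; split.
  by have := integrableD measurableT fi gi; apply: eq_integrable.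
by under eq_integral do rewrite EFinD; rewrite integralD//= fv gw.
Qed.

Lemma has_integralZ a f v : has_integral f v ->
  has_integral (fun x => a * f x) (a * v).
Proof.
move=> [fi fv]; split.
  by have := integrableZl measurableT a fi; apply: eq_integrable.
by under eq_integral do rewrite EFinM; rewrite integralZl//= fv.
Qed.

Lemma has_integralB f g v w : has_integral f v -> has_integral g w ->
  has_integral (fun x => f x - g x) (v - w).
Proof.
move=> [fi fv] [gi gw]; split.
  by have := integrableB measurableT fi gi; apply: eq_integrable.
by under eq_integral do rewrite EFinB; rewrite integralB//= fv gw.
Qed.

Lemma eq_has_integral f g v : f =1 g -> has_integral f v -> has_integral g v.
Proof. by move=> /funext ->. Qed.

Lemma ge0_has_integral f v : measurable_fun setT f -> (forall x, 0 <= f x) ->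
  (\int[mu]_x (f x)%:E = v%:E)%E -> has_integral f v.
Proof.
move=> mf f0 fv; split=> //; apply/integrableP; split.
  exact/measurable_EFinP.
under eq_integral => x _ do rewrite /= ger0_norm//.
by rewrite fv ltry.
Qed.

Lemma has_integral_uniq f v w : has_integral f v -> has_integral f w -> v = w.
Proof. by move=> [_ fv] [_]; rewrite fv => -[]. Qed.

Lemma integrable_has_integral f : mu.-integrable setT (EFin \o f) ->
  exists v, has_integral f v.
Proof.
move=> fi; exists (fine (\int[mu]_x (f x)%:E)%E); split=> //.
by rewrite fineK// integrable_fin_num.
Qed.

Lemma has_integral_dominated f g w : measurable_fun setT f ->
  has_integral g w -> (forall x, `|f x| <= g x) -> exists v, has_integral f v.
Proof.
move=> mf [gi gw] fg; apply: integrable_has_integral.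
apply: le_integrable gi => //; first exact/measurable_EFinP.
by move=> x _ /=; rewrite lee_fin (le_trans (fg x))// ler_norm.
Qed.

End has_integral.

(** * The even and odd parts of |x - y|^q as Gram kernels *)

Section kernels.
Context {R : realType}.
Local Notation mu := (@lebesgue_measure R).
Implicit Types (q t x y : R).

Definition even_kernel q x y : R := (`|x - y| `^ q + `|x + y| `^ q) / 2.
Definition odd_kernel q x y : R := (`|x + y| `^ q - `|x - y| `^ q) / 2.
(** The covariance that goes with the even part: |x|^q and |y|^q are the values of
    the even kernel on the axes. *)
Definition even_defect q x y : R :=
  `|x| `^ q + `|y| `^ q - even_kernel q x y.

(** K is the Gram kernel of the family f t, with t ranging over Lebesgue measure;
    weights are absorbed in the features. *)
Definition feature_map (f : measurableTypeR R -> R -> R) (K : R -> R -> R) :=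
  measurable_fun setT (fun z => f z.1 z.2) /\
  forall x y, has_integral mu (fun t => f t x * f t y) (K x y).

(** Reduces to x = 1 by scaling and parity of the cosine. *)
Lemma integral_coswave q : 0 < q < 2 ->
  exists2 C : R, 0 < C & forall x, has_integral mu (coswave q ^~ x) (C * `|x| `^ q).
Proof.
move=> q02; have /andP[q0 _] := q02.
have := coswave_lty q02; have := coswave_gt0 q0.
set I := (\int[mu]_t _)%E => I0 Ioo.
have IE : I = (fine I)%:E by rewrite fineK// ge0_fin_numE// ltW.
have C0 : 0 < fine I by rewrite -lte_fin -IE.
exists (fine I) => // x.
apply: ge0_has_integral.
- exact: measurable_coswave.
- by move=> t; exact: coswave_ge0.
have [->|x0] := eqVneq x 0.
  rewrite normr0 powR0 ?gt_eqF// mulr0 integral0_eq// => t _.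
  by rewrite /coswave mulr0 cos0 subrr mulr0.
have -> : (\int[mu]_t (coswave q t x)%:E = \int[mu]_t (coswave q t `|x|)%:E)%E.
  apply: eq_integral => t _; congr EFin; rewrite /coswave; congr (_ * (1 - _)).
  case: (ger0P x) => // _; by rewrite mulrN cosN.
by rewrite coswave_scale ?normr_gt0// -/I IE mulrC -EFinM.
Qed.

Lemma measurable_density_wave q (C : R) (w : R -> R) : continuous w ->
  measurable_fun setT (fun z : measurableTypeR R * R =>
    Num.sqrt (levy_density q z.1 / C) * w (z.1 * z.2)).
Proof.
move=> cw; apply: measurable_funM.
  apply: measurableT_comp => //.
    by apply: continuous_measurable_fun; exact: sqrt_continuous.
  apply: measurable_funM => //.
  exact: (measurableT_comp (measurable_levy_density q)).
apply: measurableT_comp; first exact: continuous_measurable_fun.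
by apply: measurable_funM.
Qed.

(** For q < 2 the features are 1 - cos (t x): in the product of two of them,
    cos (t x) cos (t y) is the mean of cos (t (x - y)) and cos (t (x + y)), so that
    only integrals of 1 - cos occur. For q = 2 the kernel vanishes. *)
Lemma even_defect_features q : 0 < q <= 2 ->
  exists f, feature_map f (even_defect q).
Proof.
move=> /andP[q0]; rewrite le_eqVlt => /predU1P[->|q2].
  exists (fun _ _ => 0); split; first exact: measurable_cst.
  move=> x y.
  have -> : even_defect 2 x y = 0.
    rewrite /even_defect /even_kernel !(powR_mulrn 2)// !real_normK ?num_real//.
    by field.
  apply: (eq_has_integral (f := fun=> 0)); first by move=> t; rewrite mulr0.
  by split; [exact: integrable0|rewrite integral0_eq].
have q02 : 0 < q < 2 by rewrite q0.
have [C C0 HC] := integral_coswave q02.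
exists (fun t x => Num.sqrt (levy_density q t / C) * (1 - cos (t * x))); split.
  apply: (@measurable_density_wave q C (fun u => 1 - cos u)) => u.
  by apply: cvgB; [exact: cvg_cst|exact: continuous_cos].
move=> x y.
have := has_integralZ C^-1 (has_integralB (has_integralD (HC x) (HC y))
  (has_integralZ 2^-1 (has_integralD (HC (x - y)) (HC (x + y))))).
rewrite (_ : _ * _ = even_defect q x y); last first.
  by rewrite /even_defect /even_kernel; field; rewrite gt_eqF.
apply: eq_has_integral => t.
rewrite mulrACA -expr2 sqr_sqrtr ?divr_ge0 ?levy_density_ge0 ?ltW//.
rewrite /coswave (mulrBr t) (mulrDr t) cosB cosD.
by field; rewrite gt_eqF.
Qed.

(** For q < 2 the features are sin (t x), as sin (t x) sin (t y) is half the difference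
    of cos (t (x - y)) and cos (t (x + y)). For q = 2 the kernel is 2 x y, which has a
    single feature, spread here over the unit interval. *)
Lemma odd_kernel_features q : 0 < q <= 2 ->
  exists f, feature_map f (odd_kernel q).
Proof.
move=> /andP[q0]; rewrite le_eqVlt => /predU1P[->|q2].
  pose f (t : measurableTypeR R) x : R := \1_(`[0, 1]%classic : set R) t * (Num.sqrt 2 * x).
  exists f; split.
    apply: measurable_funM; last exact: measurable_funM.
    by apply: (measurableT_comp (measurable_indic _)).
  move=> x y.
  have -> : odd_kernel 2 x y = 2 * (x * y) * 1.
    rewrite /odd_kernel !(powR_mulrn 2)// !real_normK ?num_real//.
    by field.
  have -> : (fun t => f t x * f t y) = (fun t => 2 * (x * y) * \1_(`[0, 1]%classic : set R) t).
    apply/funext => t; rewrite /f indicE.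
    have {3}<- : Num.sqrt 2 ^+ 2 = 2 :> R by rewrite sqr_sqrtr.
    by case: (_ \in _) => /=; ring.
  apply: has_integralZ; apply: ge0_has_integral => //.
  rewrite integral_indic//= setIT lebesgue_measure_itv/= lte_fin ltr01.
  by rewrite -EFinB subr0.
have q02 : 0 < q < 2 by rewrite q0.
have [C C0 HC] := integral_coswave q02.
exists (fun t x => Num.sqrt (levy_density q t / C) * sin (t * x)); split.
  exact: (@measurable_density_wave q C sin (@continuous_sin R)).
move=> x y.
have := has_integralZ C^-1 (has_integralZ 2^-1
  (has_integralB (HC (x + y)) (HC (x - y)))).
rewrite (_ : _ * _ = odd_kernel q x y); last first.
  by rewrite /odd_kernel; field; rewrite gt_eqF.
apply: eq_has_integral => t.
rewrite mulrACA -expr2 sqr_sqrtr ?divr_ge0 ?levy_density_ge0 ?ltW//.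
rewrite /coswave (mulrBr t) (mulrDr t) cosB cosD.
by field; rewrite gt_eqF.
Qed.

End kernels.

(** * Double integrals of Gram kernels *)

Section has_integral_product.
Context d1 d2 (T1 : measurableType d1) (T2 : measurableType d2) (R : realType).
Variables (m1 : {sigma_finite_measure set T1 -> \bar R})
  (m2 : {sigma_finite_measure set T2 -> \bar R}).

Lemma has_integral_fubini1 (f : T1 * T2 -> R) (g : T1 -> R) v :
  has_integral (m1 \x m2)%E f v ->
  (forall x, has_integral m2 (fun y => f (x, y)) (g x)) -> has_integral m1 g v.
Proof.
move=> [fi fv] fg.
have E : (fun x => \int[m2]_y (f (x, y))%:E)%E = EFin \o g.
  by apply/funext => x; have [_ ->] := fg x.
split; first by rewrite -E; exact: (integrable_fubini_F fi).
by rewrite -fv -(integral12_prod_meas1 fi) /fubini_F E.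
Qed.

Lemma has_integral_fubini2 (f : T1 * T2 -> R) (g : T2 -> R) v :
  has_integral (m1 \x m2)%E f v ->
  (forall y, has_integral m1 (fun x => f (x, y)) (g y)) ->
  (\int[m2]_y (g y)%:E = v%:E)%E.
Proof.
move=> [fi fv] fg.
have E : (fun y => \int[m1]_x (f (x, y))%:E)%E = EFin \o g.
  by apply/funext => x; have [_ ->] := fg x.
by rewrite -fv -(integral21_prod_meas1 fi) /fubini_G E.
Qed.

Lemma has_integral_prod (f : T1 -> R) (g : T2 -> R) v w :
  has_integral m1 f v -> has_integral m2 g w ->
  has_integral (m1 \x m2)%E (fun z => f z.1 * g z.2) (v * w).
Proof.
move=> [fi fv] [gi gw].
have [mf foo] := integrableP _ _ _ fi.
have [mg goo] := integrableP _ _ _ gi.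
have {}mf : measurable_fun setT f by exact/measurable_EFinP.
have {}mg : measurable_fun setT g by exact/measurable_EFinP.
have mfg : measurable_fun setT (fun z : T1 * T2 => (f z.1 * g z.2)%:E).
  apply/measurable_EFinP/measurable_funM.
    exact: (measurableT_comp mf).
  exact: (measurableT_comp mg).
have mfn : measurable_fun setT (fun x => `|f x|%:E).
  by apply/measurable_EFinP; exact: measurableT_comp.
have mgn : measurable_fun setT (fun x => `|g x|%:E).
  by apply/measurable_EFinP; exact: measurableT_comp.
have fgi : (m1 \x m2)%E.-integrable setT (fun z => (f z.1 * g z.2)%:E).
  apply/(integrable12ltyP m1 m2 mfg) => /=.
  under eq_integral => x _.
    under eq_integral => y _ do rewrite normrM EFinM.
    rewrite ge0_integralZl//.
    over.
  rewrite ge0_integralZr//; last exact: integral_ge0.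
  rewrite lte_mul_pinfty//.
  - exact: integral_ge0.
  - by rewrite ge0_fin_numE// integral_ge0.
split => //.
rewrite -(integral12_prod_meas1 fgi) /fubini_F/=.
under eq_integral => x _.
  under eq_integral => y _ do rewrite EFinM.
  rewrite integralZl// gw -EFinM mulrC EFinM.
  over.
by rewrite integralZl//= fv -EFinM mulrC.
Qed.

End has_integral_product.

Lemma integral_cst_probability d (Z : measurableType d) (R : realType)
    (P : probability Z R) (x : \bar R) : (\int[P]_z x = x)%E.
Proof.
transitivity (x * P setT)%E; first exact: integral_cst.
transitivity (x * 1)%E; last by rewrite mule1.
by congr (_ * _)%E; exact: probability_setT.
Qed.

Lemma has_integral_one d (Z : measurableType d) (R : realType)
    (P : probability Z R) : has_integral P (fun=> 1) 1.
Proof. by apply: ge0_has_integral => //; exact: integral_cst_probability. Qed.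

Section gram.
Context d d' (Z : measurableType d) (T : measurableType d') (R : realType).
Variables (P : probability Z R) (M : {sigma_finite_measure set T -> \bar R}).

(** By Fubini the double integral of the Gram kernel L is the integral over t of the
    square of the P-mean of F z t. The diagonal of L dominates everything:
    2 |F z t F w t| <= (F z t)^2 + (F w t)^2. *)
Lemma gram_integral_ge0 (F : Z -> T -> R) (L : Z -> Z -> R) :
  measurable_fun setT (fun p : Z * T => F p.1 p.2) ->
  (forall z w, has_integral M (fun t => F z t * F w t) (L z w)) ->
  P.-integrable setT (EFin \o (fun z => L z z)) ->
  exists2 v, 0 <= v & has_integral (P \x P)%E (fun p => L p.1 p.2) v.
Proof.
move=> mF FL Li.
pose PP : probability (Z * Z)%type R := (P \x P)%E.
pose G (p : (Z * Z) * T) := F p.1.1 p.2 * F p.1.2 p.2.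
have mG : measurable_fun setT G.
  apply: measurable_funM; apply: (measurableT_comp2 mF) => //;
    exact: measurableT_comp.
have mFt z : measurable_fun setT (F z) by exact: (measurableT_comp2 mF).
have mFz t : measurable_fun setT (F ^~ t) by exact: (measurableT_comp2 mF).
have mL : measurable_fun setT (fun z => L z z)
  by apply/measurable_EFinP; have /integrableP[] := Li.
have [l [_ HL]] := integrable_has_integral Li.
have L0 z : 0 <= L z z.
  rewrite -lee_fin; have [_ <-] := FL z z.
  by apply: integral_ge0 => t _; rewrite lee_fin -expr2 sqr_ge0.
have cst1 := has_integral_one P.
have HLl : has_integral P (fun z => L z z) l by split.
have HLL := has_integralZ 2^-1 (has_integralD (has_integral_prod HLl cst1)
  (has_integral_prod cst1 HLl)).
have Gi : (PP \x M)%E.-integrable setT (EFin \o G).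
  have mG' : measurable_fun setT (EFin \o G) by exact/measurable_EFinP.
  apply/(integrable12ltyP PP M mG') => /=.
  have [_ E] := HLL; apply: (@le_lt_trans _ _ (2^-1 * (l * 1 + 1 * l))%:E); last exact: ltry.
  rewrite -E.
  apply: ge0_le_integral => //.
  - by move=> p _; exact: integral_ge0.
  - apply: (@measurable_fun_fubini_tonelli_F _ _ _ _ _ M (fun p => `|G p|%:E)) => //.
    by apply/measurable_EFinP; exact: measurableT_comp.
  - apply/measurable_EFinP; apply: measurable_funM => //; apply: measurable_funD;
    by apply: measurable_funM => //; exact: (measurableT_comp mL).
  - move=> [z w] _ /=; rewrite mulr1 mul1r.
    have [_ <-] := has_integralZ 2^-1 (has_integralD (FL z z) (FL w w)).
    apply: ge0_le_integral => //.
    + apply/measurable_EFinP; apply: measurableT_comp => //.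
      exact: (measurable_fun_pair2 (z, w) mG).
    + apply/measurable_EFinP; apply: measurable_funM => //.
      by apply: measurable_funD; exact: measurable_funM.
    + move=> t _; rewrite lee_fin /G/= ler_norml; apply/andP; split.
        by have := sqr_ge0 (F z t + F w t); nra.
      by have := sqr_ge0 (F z t - F w t); nra.
have [v Gv] := integrable_has_integral Gi.
exists v; last first.
  apply: (has_integral_fubini1 Gv) => -[z w]; exact: FL.
have [_ vE] := Gv.
have aeH : {ae M, forall t, (0 <= \int[PP]_p (G (p, t))%:E)%E}.
  have F2i : (P \x M)%E.-integrable setT (EFin \o (fun p : Z * T => F p.1 p.2 ^+ 2)).
    have mF2 : measurable_fun setT (EFin \o (fun p : Z * T => F p.1 p.2 ^+ 2)).
      by apply/measurable_EFinP; exact: measurable_funX.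
    apply/(integrable12ltyP P M mF2) => /=.
    apply: le_lt_trans (ltry l); rewrite -HL.
    apply: ge0_le_integral => //.
    - by move=> p _; exact: integral_ge0.
    - apply: (@measurable_fun_fubini_tonelli_F _ _ _ _ _ M
        (fun p : Z * T => `|F p.1 p.2 ^+ 2|%:E)) => //.
      by apply/measurable_EFinP; apply: measurableT_comp => //; exact: measurable_funX.
    - by apply/measurable_EFinP.
    - move=> z _ /=; have [_ <-] := FL z z.
      rewrite le_eqVlt; apply/orP; left; apply/eqP; apply: eq_integral => t _.
      by rewrite ger0_norm ?sqr_ge0// expr2.
  have := ae_integrable2 F2i; apply: filterS => t Fti.
  have [a Fa] : exists a, has_integral P (F ^~ t) a.
    have [b Fb] := integrable_has_integral Fti.
    apply: (has_integral_dominated _ (has_integralD cst1 Fb)) => // z.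
    by rewrite ler_norml; apply/andP; split => /=; nra.
  have [_ ->] := has_integral_prod Fa Fa.
  by rewrite lee_fin -expr2 sqr_ge0.
rewrite -lee_fin -vE -(integral21_prod_meas1 Gi) /fubini_G.
rewrite (ae_eq_integral (fun t => `|\int[PP]_p (G (p, t))%:E|)%E) //.
- by apply: integral_ge0.
- exact: (measurable_fubini_G Gi).
- by apply: measurableT_comp => //; exact: (measurable_fubini_G Gi).
- by move: aeH; apply: filterS => t Ht _; rewrite gee0_abs.
Qed.
End gram.

Section sigma_finite_prod.
Context d1 d2 (T1 : measurableType d1) (T2 : measurableType d2) (R : realType).
Variables (m1 : {sigma_finite_measure set T1 -> \bar R})
  (m2 : {sigma_finite_measure set T2 -> \bar R}).

Lemma sigma_finite_product_measure1 : sigma_finite setT (m1 \x m2)%E.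
Proof.
have /sigma_finiteP[F [TF ndF Foo]] := sigma_finiteT m1.
have /sigma_finiteP[G [TG ndG Goo]] := sigma_finiteT m2.
exists (fun n => F n `*` G n) => [|n]; last first.
  have [mF Fn] := Foo n; have [mG Gn] := Goo n.
  split; first exact: measurableX.
  by rewrite product_measure1E// lte_mul_pinfty// ge0_fin_numE.
apply/seteqP; split => // -[x y] _.
have [n _ Fx] : (\bigcup_n F n) x by rewrite -TF.
have [m _ Gy] : (\bigcup_n G n) y by rewrite -TG.
exists (maxn n m) => //; split.
  by move: (ndF _ _ (leq_maxl n m)) => /subsetPset; apply.
by move: (ndG _ _ (leq_maxr n m)) => /subsetPset; apply.
Qed.

Definition sigma_finite_prod : {sigma_finite_measure set (T1 * T2)%type -> \bar R} :=
  HB.pack (m1 \x m2)%E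
    (Measure_isSigmaFinite.Build _ _ _ (m1 \x m2)%E sigma_finite_product_measure1).
End sigma_finite_prod.

Section kernel_product.
Context d (Z : measurableType d) (R : realType) (P : probability Z R).
Variables (X Y : Z -> R).
Hypotheses (mX : measurable_fun setT X) (mY : measurable_fun setT Y).

(** The product of two Gram kernels is the Gram kernel of the products of their
    features, indexed by the product measure. *)
Lemma kernel_product_integral_ge0 (f g : measurableTypeR R -> R -> R)
    (K H : R -> R -> R) :
  feature_map f K -> feature_map g H ->
  P.-integrable setT (EFin \o (fun z => K (X z) (X z) * H (Y z) (Y z))) ->
  exists2 v, 0 <= v & has_integral (P \x P)%E
    (fun p => K (X p.1) (X p.2) * H (Y p.1) (Y p.2)) v.
Proof.
move=> [mf fK] [mg gH] KHi.
pose M := sigma_finite_prod (@lebesgue_measure R) (@lebesgue_measure R).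
apply: (@gram_integral_ge0 _ _ _ _ _ P M
  (fun z t => f t.1 (X z) * g t.2 (Y z)) (fun z w => K (X z) (X w) * H (Y z) (Y w))) => //.
  apply: measurable_funM.
    by apply: (measurableT_comp2 mf); exact: measurableT_comp.
  by apply: (measurableT_comp2 mg); exact: measurableT_comp.
move=> z w; have := has_integral_prod (fK (X z) (X w)) (gH (Y z) (Y w)).
by apply: eq_has_integral => -[t s] /=; rewrite mulrACA.
Qed.

End kernel_product.

(** * Bounds on the kernels *)

Section powers.
Context {R : realType}.
Implicit Types (q t x y : R).

Lemma convex_norm_powR q t x y : 1 <= q -> 0 <= t <= 1 ->
  `|t * x + (1 - t) * y| `^ q <= t * `|x| `^ q + (1 - t) * `|y| `^ q.
Proof.
move=> q1 t01; have /andP[t0 t1] := t01.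
have t'0 : 0 <= 1 - t by rewrite subr_ge0.
have q0 : 0 <= q by rewrite (le_trans _ q1).
pose i := Itv01 t0 t1.
have := @convex_powR R q q1 i `|x| `|y|.
rewrite !inE/= !in_itv/= !normr_ge0 => /(_ isT isT).
rewrite !convRE/= => h; apply: le_trans h.
apply: ge0_ler_powR => //; rewrite ?nnegrE ?addr_ge0 ?mulr_ge0//.
by rewrite (le_trans (ler_normD _ _))// !normrM (ger0_norm t0) (ger0_norm t'0).
Qed.

(** Convexity at the midpoint of 2 x and 2 y gives the factor 2^(q-1) <= 2. *)
Lemma norm_powRD_le q x y : 1 <= q <= 2 ->
  `|x + y| `^ q <= 2 * (`|x| `^ q + `|y| `^ q).
Proof.
move=> /andP[q1 q2].
have h2 : 0 <= (2^-1 : R) <= 1 by lra.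
have := @convex_norm_powR q 2^-1 (2 * x) (2 * y) q1 h2.
rewrite (_ : _ + _ = x + y); last by field.
rewrite !normrM !powRM// (ger0_norm (ler0n _ 2)).
have : 2 `^ q <= 4 :> R.
  rewrite (_ : 4 = 2 `^ 2 :> R); last by rewrite (powR_mulrn 2)//; ring.
  by rewrite ler_powR// ler1n.
have := powR_ge0 `|x| q; have := powR_ge0 `|y| q; nra.
Qed.

Lemma norm_powRB_le q x y : 1 <= q <= 2 ->
  `|x - y| `^ q <= 2 * (`|x| `^ q + `|y| `^ q).
Proof. by move=> q12; have := norm_powRD_le x (- y) q12; rewrite normrN. Qed.

Lemma odd_kernel_le q x y : 1 <= q <= 2 ->
  `|odd_kernel q x y| <= 2 * (`|x| `^ q + `|y| `^ q).
Proof.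
move=> q12; rewrite /odd_kernel ler_norml.
have := norm_powRD_le x y q12; have := norm_powRB_le x y q12.
have := powR_ge0 `|x + y| q; have := powR_ge0 `|x - y| q.
by move=> *; apply/andP; split; lra.
Qed.

Lemma even_kernel_ge0 q x y : 0 <= even_kernel q x y.
Proof. by rewrite /even_kernel mulr_ge0// addr_ge0// powR_ge0. Qed.

Lemma even_kernel_le q x y : 1 <= q <= 2 ->
  even_kernel q x y <= 2 * (`|x| `^ q + `|y| `^ q).
Proof.
move=> q12; rewrite /even_kernel.
have := norm_powRD_le x y q12; have := norm_powRB_le x y q12; lra.
Qed.

Lemma even_defect_le q x y : 1 <= q <= 2 ->
  `|even_defect q x y| <= 2 * (`|x| `^ q + `|y| `^ q).
Proof.
move=> q12; rewrite /even_defect ler_norml.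
have := even_kernel_le x y q12; have := even_kernel_ge0 q x y.
have := powR_ge0 `|x| q; have := powR_ge0 `|y| q.
by move=> *; apply/andP; split; lra.
Qed.

Lemma odd_kernelC q x y : odd_kernel q x y = odd_kernel q y x.
Proof. by rewrite /odd_kernel (distrC x) (addrC x). Qed.

Lemma even_odd_kernel q x y :
  `|x - y| `^ q = even_kernel q x y - odd_kernel q x y.
Proof. by rewrite /even_kernel /odd_kernel; field. Qed.

Lemma measurable_norm_powR q : measurable_fun setT (fun x : R => `|x| `^ q).
Proof. by apply: (measurableT_comp (measurable_powR _)). Qed.

Lemma measurable_odd_kernel q :
  measurable_fun setT (fun p : R * R => odd_kernel q p.1 p.2).
Proof.
apply: measurable_funM => //; apply: measurable_funB;
  apply: (measurableT_comp (measurable_norm_powR q)).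
  exact: measurable_funD.
exact: measurable_funB.
Qed.

Lemma measurable_even_kernel q :
  measurable_fun setT (fun p : R * R => even_kernel q p.1 p.2).
Proof.
apply: measurable_funM => //; apply: measurable_funD;
  apply: (measurableT_comp (measurable_norm_powR q)).
  exact: measurable_funB.
exact: measurable_funD.
Qed.

Lemma measurable_even_defect q :
  measurable_fun setT (fun p : R * R => even_defect q p.1 p.2).
Proof.
apply: measurable_funB; last exact: measurable_even_kernel.
apply: measurable_funD; exact: (measurableT_comp (measurable_norm_powR q)).
Qed.

End powers.

(** * Replacing the cost by its even part *)

Section symmetrization.
Context d (Z : measurableType d) (R : realType) (P : probability Z R).
Variables (X Y : Z -> R) (q : R).
Hypotheses (mX : measurable_fun setT X) (mY : measurable_fun setT Y).
Hypothesis q12 : 1 <= q <= 2.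
Let r z := `|X z| `^ q.
Let s z := `|Y z| `^ q.
Let cost z w := `|X z - X w| `^ q * `|Y z - Y w| `^ q.
Let cost_sym z w := even_kernel q (X z) (X w) * even_kernel q (Y z) (Y w).
Variables vr vs : R.
Hypotheses (Hr : has_integral P r vr) (Hs : has_integral P s vs).
Hypothesis symX : forall x, has_integral P (fun z => odd_kernel q x (X z)) 0.
Hypothesis symY : forall y, has_integral P (fun z => odd_kernel q y (Y z)) 0.

Let r0 z : 0 <= r z. Proof. exact: powR_ge0. Qed.
Let s0 z : 0 <= s z. Proof. exact: powR_ge0. Qed.
Let mr : measurable_fun setT r.
Proof. exact: (measurableT_comp (measurable_norm_powR q) mX). Qed.
Let ms : measurable_fun setT s.
Proof. exact: (measurableT_comp (measurable_norm_powR q) mY). Qed.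

Let one := has_integral_one P.

Let mXX : measurable_fun setT (fun p : Z * Z => (X p.1, X p.2)).
Proof. by apply: measurable_fun_pair; exact: measurableT_comp. Qed.
Let mYY : measurable_fun setT (fun p : Z * Z => (Y p.1, Y p.2)).
Proof. by apply: measurable_fun_pair; exact: measurableT_comp. Qed.

Let mcost : measurable_fun setT (fun p : Z * Z => cost p.1 p.2).
Proof.
apply: measurable_funM; apply: (measurableT_comp (measurable_norm_powR q)).
  by apply: measurable_funB; exact: measurableT_comp.
by apply: measurable_funB; exact: measurableT_comp.
Qed.

Let mcost_sym : measurable_fun setT (fun p : Z * Z => cost_sym p.1 p.2).
Proof.
apply: measurable_funM.
  exact: (measurableT_comp (measurable_even_kernel q) mXX).
exact: (measurableT_comp (measurable_even_kernel q) mYY).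
Qed.

Let cost0 z w : 0 <= cost z w. Proof. by rewrite mulr_ge0 ?powR_ge0. Qed.
Let cost_sym0 z w : 0 <= cost_sym z w.
Proof. by rewrite mulr_ge0 ?even_kernel_ge0. Qed.

Section finite.
Variable v : R.
Hypothesis Hrs : has_integral P (fun z => r z * s z) v.

Let Hdom : exists w, has_integral (P \x P)%E
  (fun p => (r p.1 + r p.2) * (s p.1 + s p.2)) w.
Proof.
have := has_integralD
  (has_integralD (has_integral_prod Hrs one) (has_integral_prod one Hrs))
  (has_integralD (has_integral_prod Hr Hs) (has_integral_prod Hs Hr)).
move=> H; eexists; apply: eq_has_integral H => p /=; ring.
Qed.

Let kernels_has_integral (K H : R -> R -> R) :
  measurable_fun setT (fun p : R * R => K p.1 p.2) ->
  measurable_fun setT (fun p : R * R => H p.1 p.2) ->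
  (forall x y, `|K x y| <= 2 * (`|x| `^ q + `|y| `^ q)) ->
  (forall x y, `|H x y| <= 2 * (`|x| `^ q + `|y| `^ q)) ->
  exists w, has_integral (P \x P)%E
    (fun p => K (X p.1) (X p.2) * H (Y p.1) (Y p.2)) w.
Proof.
move=> mK mH hK hH; have [w Hw] := Hdom.
apply: (has_integral_dominated _ (has_integralZ 4 Hw)).
  apply: measurable_funM.
    exact: (measurableT_comp mK mXX).
  exact: (measurableT_comp mH mYY).
move=> p; rewrite normrM (_ : 4 * _ =
  (2 * (r p.1 + r p.2)) * (2 * (s p.1 + s p.2))); last by ring.
by apply: ler_pM.
Qed.

Let diag_integrable (K H : R -> R -> R) :
  measurable_fun setT (fun p : R * R => K p.1 p.2) ->
  measurable_fun setT (fun p : R * R => H p.1 p.2) ->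
  (forall x y, `|K x y| <= 2 * (`|x| `^ q + `|y| `^ q)) ->
  (forall x y, `|H x y| <= 2 * (`|x| `^ q + `|y| `^ q)) ->
  P.-integrable setT (EFin \o (fun z => K (X z) (X z) * H (Y z) (Y z))).
Proof.
move=> mK mH hK hH.
have mKX := measurableT_comp2 mK mX mX.
have mHY := measurableT_comp2 mH mY mY.
have [|z|w []//] := has_integral_dominated
  (f := fun z => K (X z) (X z) * H (Y z) (Y z)) _ (has_integralZ 16 Hrs).
  exact: measurable_funM.
rewrite normrM (_ : 16 * _ = (2 * (r z + r z)) * (2 * (s z + s z))); last by ring.
by apply: ler_pM.
Qed.

(** With k, h, d the even kernel, the odd kernel and the even defect, the cost is
    (k_X - h_X) (k_Y - h_Y), where k_X = r + r' - d_X and k_Y = s + s' - d_Y. Hence the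
    cost minus k_X k_Y is h_X h_Y + d_X h_Y + h_X d_Y - (r + r') h_Y - (s + s') h_X. The
    first three terms have nonnegative double integrals, being products of Gram kernels,
    and the last two integrate to 0 because h is odd and the marginals are symmetric. *)
Lemma symmetrization_le_finite : exists w w', [/\ w' <= w,
  has_integral (P \x P)%E (fun p => cost p.1 p.2) w &
  has_integral (P \x P)%E (fun p => cost_sym p.1 p.2) w'].
Proof.
have q02 : 0 < q <= 2 by move: q12 => /andP[q1 ->]; rewrite andbT (lt_le_trans ltr01).
have [f hf] := even_defect_features q02.
have [g hg] := odd_kernel_features q02.
have mo := measurable_odd_kernel q.
have md := measurable_even_defect q.
have me := measurable_even_kernel q.
have ho x y := odd_kernel_le x y q12.
have hd x y := even_defect_le x y q12.
have he x y : `|even_kernel q x y| <= 2 * (`|x| `^ q + `|y| `^ q).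
  by rewrite ger0_norm ?even_kernel_ge0// even_kernel_le.
have [v1 v10 H1] := kernel_product_integral_ge0 mX mY hg hg (diag_integrable mo mo ho ho).
have [v2 v20 H2] := kernel_product_integral_ge0 mX mY hf hg (diag_integrable md mo hd ho).
have [v3 v30 H3] := kernel_product_integral_ge0 mX mY hg hf (diag_integrable mo md ho hd).
have [w' Hw'] := kernels_has_integral me me he he.
have [wd Hwd] := Hdom.
have zero (a W : Z -> R) :
    measurable_fun setT a -> measurable_fun setT W -> (forall z, 0 <= a z) ->
    (forall p : Z * Z, (a p.1 + a p.2) * `|odd_kernel q (W p.1) (W p.2)| <=
       2 * ((r p.1 + r p.2) * (s p.1 + s p.2))) ->
    (forall x, has_integral P (fun z => odd_kernel q x (W z)) 0) ->
  has_integral (P \x P)%E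
    (fun p => (a p.1 + a p.2) * odd_kernel q (W p.1) (W p.2)) 0.
  move=> ma mW a0 dom symW.
  have mo2 : measurable_fun setT (fun p : Z * Z => odd_kernel q (W p.1) (W p.2)).
    by apply: (measurableT_comp2 mo); exact: measurableT_comp.
  have [|p|z1 Hz1] := has_integral_dominated
    (f := fun p : Z * Z => a p.1 * odd_kernel q (W p.1) (W p.2)) _
    (has_integralZ 2 Hwd).
  - by apply: measurable_funM => //; exact: (measurableT_comp ma).
  - apply: le_trans (dom p); rewrite normrM ger0_norm//.
    by rewrite ler_wpM2r// lerDl.
  have [|p|z2 Hz2] := has_integral_dominated
    (f := fun p : Z * Z => a p.2 * odd_kernel q (W p.1) (W p.2)) _
    (has_integralZ 2 Hwd).
  - by apply: measurable_funM => //; exact: (measurableT_comp ma).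
  - apply: le_trans (dom p); rewrite normrM ger0_norm//.
    by rewrite ler_wpM2r// lerDr.
  have z10 : z1 = 0.
    have [_] := has_integral_fubini1 (g := fun z => a z * 0) Hz1
      (fun z => has_integralZ (a z) (symW (W z))).
    rewrite integral0_eq; first by case.
    by move=> z _; rewrite mulr0.
  have z20 : z2 = 0.
    have H z : has_integral P (fun u => a z * odd_kernel q (W u) (W z)) (a z * 0).
      apply: has_integralZ; apply: eq_has_integral (symW (W z)) => u.
      exact: odd_kernelC.
    have := has_integral_fubini2 (g := fun z => a z * 0) Hz2 H.
    rewrite integral0_eq; first by case.
    by move=> z _; rewrite mulr0.
  have := has_integralD Hz1 Hz2; rewrite z10 z20 addr0.
  by apply: eq_has_integral => p; rewrite mulrDl.
have S1 : has_integral (P \x P)%E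
    (fun p => (r p.1 + r p.2) * odd_kernel q (Y p.1) (Y p.2)) 0.
  apply: zero => // p; rewrite mulrCA ler_wpM2l ?addr_ge0//; exact: ho.
have S2 : has_integral (P \x P)%E
    (fun p => (s p.1 + s p.2) * odd_kernel q (X p.1) (X p.2)) 0.
  apply: zero => // p.
  rewrite (mulrC (r _ + _)) mulrCA ler_wpM2l ?addr_ge0//; exact: ho.
exists (w' + (v1 + v2 + v3) - (0 + 0)), w'; split=> //; first by lra.
have := has_integralB (has_integralD Hw'
  (has_integralD (has_integralD H1 H2) H3)) (has_integralD S1 S2).
apply: eq_has_integral => p.
rewrite /cost !even_odd_kernel /even_defect -/(r _) -/(s _).
by rewrite /r /s; ring.
Qed.
End finite.

(** Only a finite cost needs an argument. It makes the inner integral finite for some w,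
    and a translation by (X w, Y w) then shows that |X|^q |Y|^q is integrable, which is
    what dominates all the kernels. *)
Lemma symmetrization_le :
  (\int[P]_w \int[P]_z (cost_sym z w)%:E <= \int[P]_w \int[P]_z (cost z w)%:E)%E.
Proof.
have [->|finite_cost] := eqVneq (\int[P]_w \int[P]_z (cost z w)%:E)%E +oo%E.
  exact: leey.
have [w wfin] : exists w, (\int[P]_z (cost z w)%:E < +oo)%E.
  apply/not_existsP => H; move/eqP: finite_cost; apply.
  rewrite (eq_integral (cst +oo%E)); last first.
    by move=> w _; apply/eqP; rewrite -leye_eq leNgt; apply/negP; exact: H.
  exact: integral_cst_probability.
have [c Hc] : exists c, has_integral P (fun z => cost z w) c.
  exists (fine (\int[P]_z (cost z w)%:E)%E); apply: ge0_has_integral => //.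
    exact: (measurable_fun_pair1 w mcost).
  by rewrite fineK// ge0_fin_numE//; apply: integral_ge0 => z _; rewrite lee_fin.
have [|z|cX HcX] := has_integral_dominated (f := fun z => `|X z - X w| `^ q) _
  (has_integralZ 2 (has_integralD Hr (has_integralZ (r w) one))).
- apply: (measurableT_comp (measurable_norm_powR q)).
  exact: measurable_funB.
- by rewrite ger0_norm ?powR_ge0// mulr1; exact: norm_powRB_le.
have [|z|cY HcY] := has_integral_dominated (f := fun z => `|Y z - Y w| `^ q) _
  (has_integralZ 2 (has_integralD Hs (has_integralZ (s w) one))).
- apply: (measurableT_comp (measurable_norm_powR q)).
  exact: measurable_funB.
- by rewrite ger0_norm ?powR_ge0// mulr1; exact: norm_powRB_le.
have [|z|v Hv] := has_integral_dominated (f := fun z => r z * s z) _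
  (has_integralZ 4 (has_integralD (has_integralD Hc (has_integralZ (s w) HcX))
    (has_integralD (has_integralZ (r w) HcY) (has_integralZ (r w * s w) one)))).
- exact: measurable_funM.
- rewrite ger0_norm ?mulr_ge0// (_ : 4 * _ =
    (2 * (`|X z - X w| `^ q + r w)) * (2 * (`|Y z - Y w| `^ q + s w))); last first.
    by rewrite /cost; ring.
  apply: ler_pM => //.
    by have := norm_powRD_le (X z - X w) (X w) q12; rewrite subrK.
  by have := norm_powRD_le (Y z - Y w) (Y w) q12; rewrite subrK.
have [a [b [ba [_ Ha] [_ Hb]]]] := symmetrization_le_finite Hv.
have fub (f : Z -> Z -> R) : measurable_fun setT (fun p : Z * Z => f p.1 p.2) ->
    (forall z w, 0 <= f z w) ->
    (\int[P]_w \int[P]_z (f z w)%:E = \int[P \x P]_p (f p.1 p.2)%:E)%E.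
  move=> mf f0; rewrite (@fubini_tonelli2 _ _ _ _ _ P P (fun p => (f p.1 p.2)%:E))//.
    exact/measurable_EFinP.
  by move=> p; rewrite lee_fin.
by rewrite !fub// Ha Hb lee_fin.
Qed.

End symmetrization.

(** * Monotonicity of the even kernel *)

Section even_kernel_monotone.
Context {R : realType}.
Implicit Types (q x y c : R).

(** The even kernel is the even part of the convex function |x - c|^q, and x is a convex
    combination of y and - y. *)
Lemma even_kernel_nondecreasing q x y c : 1 <= q -> 0 <= x -> x <= y ->
  even_kernel q x c <= even_kernel q y c.
Proof.
move=> q1 x0 xy; have [y0|y0] := eqVneq y 0.
  by rewrite y0 in xy *; rewrite (le_anti (introT andP (conj xy x0))).
have yp : 0 < y by rewrite lt0r y0 (le_trans x0).
(* the solution of x = t * y + (1 - t) * (- y) *)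
pose t := (y + x) / (2 * y).
have t01 : 0 <= t <= 1.
  rewrite /t divr_ge0 ?addr_ge0 ?mulr_ge0 ?(ltW yp)//=.
  by rewrite ler_pdivrMr ?mulr_gt0//; lra.
have h1 := convex_norm_powR (y - c) (- y - c) q1 t01.
have h2 := convex_norm_powR (y + c) (- y + c) q1 t01.
rewrite (_ : t * (y - c) + _ = x - c) in h1; last by rewrite /t; field.
rewrite (_ : t * (y + c) + _ = x + c) in h2; last by rewrite /t; field.
rewrite (_ : `|- y - c| = `|y + c|) in h1; last by rewrite -opprD normrN.
rewrite (_ : `|- y + c| = `|y - c|) in h2; last by rewrite -normrN opprD opprK.
by rewrite /even_kernel ler_wpM2r// (le_trans (lerD h1 h2))//; lra.
Qed.

Lemma even_kernelN q x c : even_kernel q (- x) c = even_kernel q x c.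
Proof.
rewrite /even_kernel -opprD normrN addrC.
by rewrite (_ : - x + c = - (x - c)) ?normrN// opprB addrC.
Qed.

Lemma even_kernelC q x y : even_kernel q x y = even_kernel q y x.
Proof. by rewrite /even_kernel (distrC x) (addrC x). Qed.

End even_kernel_monotone.

(** * Countermonotone pairs minimize the integral of a product *)

Section layer_cake.
Context {R : realType}.
Local Notation mu := (@lebesgue_measure R).
Implicit Types (a t : R).

(** Layer-cake decomposition: a nonnegative a is the integral over t of its layers. *)
Definition layer t a : R := if (0 <= t) && (t < a) then 1 else 0.

Lemma layer_ge0 t a : 0 <= layer t a.
Proof. by rewrite /layer; case: ifP. Qed.

Lemma measurable_layer :
  measurable_fun setT (fun p : measurableTypeR R * R => layer p.1 p.2).
Proof.
apply: measurable_fun_ifT => //; apply: measurable_and.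
  by apply: measurable_fun_ler.
by apply: measurable_fun_ltr.
Qed.

Lemma integral_layer a : 0 <= a -> (\int[mu]_t (layer t a)%:E = a%:E)%E.
Proof.
move=> a0.
have -> : (fun t => (layer t a)%:E) = (fun t => (\1_(`[0, a[%classic : set R) t)%:E).
  apply/funext => t; rewrite /layer indicE mem_setE in_itv/=.
  by case: ifP.
rewrite integral_indic//= setIT lebesgue_measure_itv/= lte_fin.
by case: ltgtP a0 => // [_|<-] _; rewrite ?oppr0 ?adde0 ?oppe0 ?adde0.
Qed.

Lemma ge0_integral_layer d (T : measurableType d) (P : probability T R)
    (w f : T -> R) :
  measurable_fun setT w -> measurable_fun setT f ->
  (forall x, 0 <= w x) -> (forall x, 0 <= f x) ->
  (\int[P]_x (w x * f x)%:E = \int[mu]_t \int[P]_x (w x * layer t (f x))%:E)%E.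
Proof.
move=> mw mf w0 f0.
have mwl : measurable_fun setT
    (fun p : T * measurableTypeR R => (w p.1 * layer p.2 (f p.1))%:E).
  apply/measurable_EFinP; apply: measurable_funM; first exact: (measurableT_comp mw).
  by apply: (measurableT_comp2 measurable_layer) => //; exact: (measurableT_comp mf).
rewrite -(@fubini_tonelli _ _ _ _ _ P mu
  (fun p => (w p.1 * layer p.2 (f p.1))%:E))//=; last first.
  by move=> p; rewrite lee_fin mulr_ge0// layer_ge0.
apply: eq_integral => x _.
under eq_integral do rewrite EFinM.
rewrite ge0_integralZl//.
- by rewrite integral_layer.
- by apply/measurable_EFinP; exact: (measurableT_comp2 measurable_layer).
- by move=> t _; rewrite lee_fin layer_ge0.
- by rewrite lee_fin.
Qed.

Lemma measurable_superlevel d (T : measurableType d) (f : T -> R) u :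
  measurable_fun setT f -> measurable [set x | u < f x].
Proof.
move=> mf; rewrite (_ : [set x | _] = f @^-1` `]u, +oo[%classic).
  by rewrite -[X in measurable X]setTI; exact: mf.
by apply/seteqP; split => x /=; rewrite in_itv/= andbT.
Qed.

Lemma indic_superlevel (T : Type) (f : T -> R) u x :
  \1_[set y | u < f y] x = (u < f x)%R%:R :> R.
Proof.
rewrite indicE; congr (nat_of_bool _)%:R.
by apply/idP/idP => [/set_mem|/mem_set].
Qed.

Lemma integral_superlevel d (T : measurableType d) (P : probability T R)
    (f : T -> R) u : measurable_fun setT f ->
  (\int[P]_x (\1_[set y | (u < f y)%R] x)%:E = P [set y | (u < f y)%R])%E.
Proof.
move=> mf; rewrite integral_indic ?setIT//; exact: measurable_superlevel.
Qed.

Section compare.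
Context d1 d2 (T1 : measurableType d1) (T2 : measurableType d2).
Variables (P1 : probability T1 R) (P2 : probability T2 R).

(** Cutting one factor into layers compares integrals of products through the level
    sets of that factor; a second use cuts the other factor. *)
Lemma le_integral_layer (w1 f1 : T1 -> R) (w2 f2 : T2 -> R) :
  measurable_fun setT w1 -> measurable_fun setT f1 ->
  measurable_fun setT w2 -> measurable_fun setT f2 ->
  (forall x, 0 <= w1 x) -> (forall x, 0 <= f1 x) ->
  (forall x, 0 <= w2 x) -> (forall x, 0 <= f2 x) ->
  (forall t, (\int[P1]_x (w1 x * layer t (f1 x))%:E <=
              \int[P2]_x (w2 x * layer t (f2 x))%:E)%E) ->
  (\int[P1]_x (w1 x * f1 x)%:E <= \int[P2]_x (w2 x * f2 x)%:E)%E.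
Proof.
move=> mw1 mf1 mw2 mf2 w10 f10 w20 f20 H.
rewrite !ge0_integral_layer//; apply: ge0_le_integral => //.
- by move=> t _; apply: integral_ge0 => x _; rewrite lee_fin mulr_ge0// layer_ge0.
- apply: (@measurable_fun_fubini_tonelli_F _ _ _ _ _ P1
    (fun p : measurableTypeR R * T1 => (w1 p.2 * layer p.1 (f1 p.2))%:E)) => //.
    apply/measurable_EFinP; apply: measurable_funM; first exact: (measurableT_comp mw1).
    by apply: (measurableT_comp2 measurable_layer) => //; exact: (measurableT_comp mf1).
  by move=> p; rewrite lee_fin mulr_ge0// layer_ge0.
- apply: (@measurable_fun_fubini_tonelli_F _ _ _ _ _ P2
    (fun p : measurableTypeR R * T2 => (w2 p.2 * layer p.1 (f2 p.2))%:E)) => //.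
    apply/measurable_EFinP; apply: measurable_funM; first exact: (measurableT_comp mw2).
    by apply: (measurableT_comp2 measurable_layer) => //; exact: (measurableT_comp mf2).
  by move=> p; rewrite lee_fin mulr_ge0// layer_ge0.
Qed.

Lemma le_integral_tails (f1 g1 : T1 -> R) (f2 g2 : T2 -> R) :
  measurable_fun setT f1 -> measurable_fun setT g1 ->
  measurable_fun setT f2 -> measurable_fun setT g2 ->
  (forall x, 0 <= f1 x) -> (forall x, 0 <= g1 x) ->
  (forall x, 0 <= f2 x) -> (forall x, 0 <= g2 x) ->
  (forall s t, (P1 ([set x | (s < f1 x)%R] `&` [set x | (t < g1 x)%R]) <=
                P2 ([set x | (s < f2 x)%R] `&` [set x | (t < g2 x)%R]))%E) ->
  (\int[P1]_x (f1 x * g1 x)%:E <= \int[P2]_x (f2 x * g2 x)%:E)%E.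
Proof.
move=> mf1 mg1 mf2 mg2 f10 g10 f20 g20 H.
have ml d (T : measurableType d) (f : T -> R) t : measurable_fun setT f ->
    measurable_fun setT (fun x => layer t (f x)).
  by move=> mf; exact: (measurableT_comp2 measurable_layer).
apply: le_integral_layer => // t.
under eq_integral do rewrite mulrC.
under [leRHS]eq_integral do rewrite mulrC.
apply: le_integral_layer => //; [exact: ml|exact: ml| | |].
- by move=> x; exact: layer_ge0.
- by move=> x; exact: layer_ge0.
move=> s.
have E d (T : measurableType d) (P : probability T R) (f g : T -> R) :
    measurable_fun setT f -> measurable_fun setT g ->
    (\int[P]_x (layer t (g x) * layer s (f x))%:E =
     if ((0 <= s) && (0 <= t))%R then
     P ([set x | (s < f x)%R] `&` [set x | (t < g x)%R]) else 0)%E.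
  move=> mf mg; case: ifPn => [/andP[s0 t0]|st].
    have mfs := measurable_superlevel s mf; have mgt := measurable_superlevel t mg.
    rewrite -[X in P X]setIT -integral_indic//; last exact: measurableI.
    apply: eq_integral => x _; congr EFin; rewrite /layer s0 t0/= indicI/=.
    by rewrite !indic_superlevel mulrC; case: ifP; case: ifP.
  rewrite integral0_eq// => x _; rewrite /layer.
  by move: st; rewrite negb_and => /orP[/negbTE->|/negbTE->]; rewrite ?mul0r ?mulr0.
rewrite !E//; case: ifP => // _; exact: H.
Qed.

(** If s < f1 and t < g1 both hold at a point of I, then countermonotonicity forces one of
    them to hold at each point of I, and their joint probability attains the lower
    bound P(E) + P(F) - 1 valid for all pairs of events; otherwise it is 0. *)
Lemma countermonotone_minimal (f1 g1 : T1 -> R) (f2 g2 : T2 -> R) (I : set T1) :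
  measurable_fun setT f1 -> measurable_fun setT g1 ->
  measurable_fun setT f2 -> measurable_fun setT g2 ->
  (forall x, 0 <= f1 x) -> (forall x, 0 <= g1 x) ->
  (forall x, 0 <= f2 x) -> (forall x, 0 <= g2 x) ->
  measurable I -> P1 I = 1%E ->
  (forall x y, I x -> I y -> (f1 x - f1 y) * (g1 x - g1 y) <= 0) ->
  (forall s, P1 [set x | s < f1 x] = P2 [set x | s < f2 x]) ->
  (forall s, P1 [set x | s < g1 x] = P2 [set x | s < g2 x]) ->
  (\int[P1]_x (f1 x * g1 x)%:E <= \int[P2]_x (f2 x * g2 x)%:E)%E.
Proof.
move=> mf1 mg1 mf2 mg2 f10 g10 f20 g20 mI PI cm tf tg.
apply: le_integral_tails => // s t.
set A1 := [set x | (s < f1 x)%R]; set B1 := [set x | (t < g1 x)%R].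
set A2 := [set x | (s < f2 x)%R]; set B2 := [set x | (t < g2 x)%R].
have mA1 : measurable A1 by exact: measurable_superlevel.
have mB1 : measurable B1 by exact: measurable_superlevel.
have mA2 : measurable A2 by exact: measurable_superlevel.
have mB2 : measurable B2 by exact: measurable_superlevel.
have [[x0 [[Ax0 Bx0] Ix0]]|disj] := pselect (A1 `&` B1 `&` I !=set0); last first.
  have -> : P1 (A1 `&` B1) = 0%E; last exact: measure_ge0.
  apply: (@subset_measure0 _ _ _ P1 _ (~` I)) => //.
  - exact: measurableI.
  - exact: measurableC.
  - by move=> x ABx Ix; apply: disj; exists x.
  - have E := probability_setC P1 mI; rewrite PI subee// in E; exact: E.
have PU1 : P1 (A1 `|` B1) = 1%E.
  have mU1 : measurable (A1 `|` B1) by exact: measurableU.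
  apply/eqP; rewrite eq_le probability_le1//= -PI.
  apply: le_measure; rewrite ?inE// => y Iy.
  apply: contrapT => /not_orP[/negP + /negP]; rewrite /A1 /B1/= -!leNgt => fy gy.
  have := cm _ _ Ix0 Iy; rewrite leNgt => /negP; apply.
  rewrite mulr_gt0// subr_gt0.
    exact: le_lt_trans fy Ax0.
  exact: le_lt_trans gy Bx0.
have H1 : (P1 A1 + P1 B1 = 1 + P1 (A1 `&` B1))%E.
  rewrite -PU1 measureUfinl ?subeK ?fin_num_measure//; first exact: measurableI.
  by rewrite (le_lt_trans (probability_le1 _ _))// ltry.
have H2 : (P2 A2 + P2 B2 <= 1 + P2 (A2 `&` B2))%E.
  have <- : (P2 (A2 `|` B2) + P2 (A2 `&` B2) = P2 A2 + P2 B2)%E.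
    rewrite measureUfinl ?subeK ?fin_num_measure//; first exact: measurableI.
    by rewrite (le_lt_trans (probability_le1 _ _))// ltry.
  by apply: leeD2r; apply: probability_le1; exact: measurableU.
rewrite -(@leeD2lE _ 1)// -H1 tf tg; exact: H2.
Qed.

End compare.
End layer_cake.

(** * Quantiles and the uniform law *)

Section quantile.
Context {R : realType} (mu : probability R R).

Let idR : R -> R := idfun.
#[local] HB.instance Definition _ :=
  @isMeasurableFun.Build _ _ _ _ idR (@measurable_id _ _ setT).

Let F (x : R) : \bar R := mu `]-oo, x]%classic.
Let FE : F = cdf (idR : {RV mu >-> R}).
Proof.
by apply/funext => x; rewrite /cdf /distribution /pushforward preimage_id.
Qed.

Let F_nd x y : x <= y -> (F x <= F y)%E.
Proof. by rewrite FE; exact: cdf_nondecreasing. Qed.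

(** The Galois connection between the quantile and the distribution function; the
    direct implication rests on right continuity. *)
Lemma quantile_le t x : 0 < t < 1 ->
  (quantile mu t <= x) = (t%:E <= mu `]-oo, x]%classic)%E.
Proof.
move=> /andP[t0 t1]; rewrite -/(F x).
pose S := [set y | (t%:E <= F y)%E].
have S0 : S !=set0.
  have := cvg_cdfy1 (idR : {RV mu >-> R}).
  rewrite -FE => /(_ [set u | (t%:E < u)%E]) h.
  have /h [M [_ HM]] : nbhs (1%E : \bar R) [set u | (t%:E < u)%E].
    by apply: open_ereal_gt'; rewrite lte_fin.
  by exists (M + 1); apply/ltW/(HM (M + 1)); rewrite ltrDl.
have Slb : has_lbound S.
  have := cvg_cdfNy0 (idR : {RV mu >-> R}).
  rewrite -FE => /(_ [set u | (u < t%:E)%E]) h.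
  have /h [M [_ HM]] : nbhs (0%E : \bar R) [set u | (u < t%:E)%E].
    by apply: open_ereal_lt'; rewrite lte_fin.
  exists M => y Sy; rewrite leNgt; apply/negP => /HM/=.
  by rewrite ltNge => /negP; apply; exact: Sy.
apply/idP/idP => [Qx|tx]; last exact: ge_inf.
rewrite leNgt; apply/negP => Fxt.
have := @cdf_right_continuous _ _ _ mu (idR : {RV mu >-> R}) x.
rewrite -FE => /(_ [set u | (u < t%:E)%E]) h.
have /h : nbhs (F x) [set u | (u < t%:E)%E] by exact: open_ereal_lt'.
move=> [e /= e0 He].
have [y Sy yx] : exists2 y, S y & y < x + e / 2.
  apply: (@inf_lt _ S) => //.
  by rewrite (le_lt_trans Qx)// ltrDl divr_gt0.
have : (F (x + e / 2) < t%:E)%E.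
  apply: (He (x + e / 2)); last by rewrite ltrDl divr_gt0.
  rewrite /ball/= opprD addrA subrr sub0r normrN gtr0_norm ?divr_gt0//.
  by rewrite ltr_pdivrMr// ltr_pMr// ltr1n.
rewrite ltNge => /negP; apply; apply: le_trans Sy _; exact/F_nd/ltW.
Qed.

End quantile.

Section uniform.
Context {R : realType}.
Local Notation mu := (@lebesgue_measure R).
Local Notation U := (uniform_prob (@ltr01 R)).
Implicit Types (a b c d w : R) (G : R -> \bar R).

Lemma integral_uniform01 G : measurable_fun setT G -> (forall w, (0 <= G w)%E) ->
  (\int[U]_w G w = \int[mu]_(w in `]0%R, 1%R[) G w)%E.
Proof.
move=> mG G0; rewrite integral_uniform// subr0 invr1 mul1e.
by apply: integral_itv_bndoo; exact: measurable_funTS.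
Qed.

Lemma integral_uniform_affine a b c d G : a != 0 ->
  (forall w, (0 < w < 1) = (c < a * w + b < d)) ->
  measurable_fun setT G -> (forall w, (0 <= G w)%E) ->
  (\int[U]_w G (a * w + b)%R = (`|a|^-1)%:E * \int[mu]_(t in `]c, d[) G t)%E.
Proof.
move=> a0 cd mG G0.
rewrite integral_uniform01//; last exact: (measurableT_comp mG (measurable_affine a b)).
pose H := G \_ (`]c, d[%classic).
have mH : measurable_fun setT H.
  have mcd : measurable (`]c, d[%classic : set R) by [].
  apply: ((measurable_restrictT G mcd).1); exact: measurable_funTS.
rewrite [in LHS]integral_mkcond [in RHS]integral_mkcond.
rewrite -/H -(@ge0_integral_affine _ a b H)//.
- apply: eq_integral => w _; rewrite /H !patchE !mem_setE !in_itv/=.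
  by rewrite cd.

- by move=> w; rewrite /H patchE; case: ifP.
Qed.

Lemma integral_uniform_flip G :
  measurable_fun setT G -> (forall w, (0 <= G w)%E) ->
  (\int[U]_w G (1 - w)%R = \int[U]_w G w)%E.
Proof.
move=> mG G0; rewrite [RHS]integral_uniform01//.
have -> : (fun w => G (1 - w)) = (fun w => G ((-1) * w + 1)).
  by apply/funext => w; congr G; ring.
rewrite (@integral_uniform_affine (-1) 1 0 1)//.
  by rewrite normrN normr1 invr1 mul1e.
by move=> w; apply/idP/idP => /andP[? ?]; apply/andP; split; lra.
Qed.

(** The two halves of the unit interval, each rescaled to the whole. *)
Lemma integral_uniform_fold G :
  measurable_fun setT G -> (forall w, (0 <= G w)%E) ->
  (2%:E * \int[U]_w G w =
   \int[U]_w G ((1 - w) / 2)%R + \int[U]_w G ((1 + w) / 2)%R)%E.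
Proof.
move=> mG G0; rewrite integral_uniform01//.
have -> : (fun w => G ((1 - w) / 2)) = (fun w => G ((- 2^-1) * w + 2^-1)).
  by apply/funext => w; congr G; field.
have -> : (fun w => G ((1 + w) / 2)) = (fun w => G (2^-1 * w + 2^-1)).
  by apply/funext => w; congr G; field.
rewrite (@integral_uniform_affine (- 2^-1) 2^-1 0 2^-1)//; last first.
  by move=> w; apply/idP/idP => /andP[? ?]; apply/andP; split; lra.
rewrite (@integral_uniform_affine 2^-1 2^-1 2^-1 1)//; last first.
  by move=> w; apply/idP/idP => /andP[? ?]; apply/andP; split; lra.
rewrite normrN gtr0_norm// invrK -ge0_muleDr; last 2 first.
- exact: integral_ge0.
- exact: integral_ge0.
congr (_ * _)%E.
have -> : (\int[mu]_(t in `]2^-1%R, 1%R[) G t = \int[mu]_(t in `[2^-1%R, 1%R[) G t)%E.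
  by apply/esym/integral_itv_bndoo; exact: measurable_funTS.
rewrite -ge0_integral_setU//.
- congr (integral _ _ _); apply/seteqP; split => t /=; rewrite !in_itv/=.
    by move=> /andP[-> ->]; rewrite andbT; case: (ltP t 2^-1); [left|right].
  by case=> /andP[h1 h2]; apply/andP; split; lra.
- exact: measurable_funTS.
- apply/disj_setPRL => t /=; rewrite !in_itv/= => /andP[t1 _] /andP[_].
  by rewrite ltNge t1.
Qed.

Lemma uniform_prob01E (A : set R) : measurable A ->
  U A = mu (A `&` `]0, 1[%classic).
Proof.
move=> mA; transitivity (\int[U]_w (\1_A w)%:E)%E.
  by rewrite integral_indic// setIT.
rewrite integral_uniform01//; last first.
  by apply: measurableT_comp => //; exact: measurable_indic.
by rewrite integral_indic.
Qed.

Lemma uniform_prob_itv c : 0 <= c <= 1 -> U `]c, +oo[%classic = (1 - c)%:E.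
Proof.
move=> /andP[c0 c1]; rewrite uniform_prob01E//.
have -> : `]c, +oo[%classic `&` `]0, 1[%classic = `]c, 1[%classic :> set R.
  apply/seteqP; split => t /=; rewrite !in_itv/= andbT.
    by move=> [-> /andP[_ ->]].
  by move=> /andP[ct ->]; rewrite ct (le_lt_trans c0).
rewrite lebesgue_measure_itv/= lte_fin; case: ltgtP c1 => // ->; by rewrite ?subrr.
Qed.

Lemma ae_uniform (C : set R) (P : R -> Prop) : countable C ->
  (forall w, 0 < w < 1 -> ~ C w -> P w) -> {ae U, forall w, P w}.
Proof.
move=> cC CP.
have mC : measurable C.
  by apply: countable_measurable => // x; exact: measurable_set1.
have mI : measurable (~` `]0, 1[%classic : set R) by exact: measurableC.
exists (C `|` ~` `]0, 1[%classic); split.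
- exact: measurableU.
- transitivity (mu ((C `|` ~` `]0, 1[%classic) `&` `]0, 1[%classic)).
    by apply: uniform_prob01E; exact: measurableU.
  apply: (@subset_measure0 _ _ _ mu _ C) => //.
  + by apply: measurableI => //; exact: measurableU.
  + by move=> w [[]].
  + exact: countable_lebesgue_measure0.
- move=> w /= nP; apply: contrapT => /not_orP[nC].
  by rewrite /= in_itv/= => /contrapT w01; apply: nP; exact: CP.
Qed.

End uniform.

Section quantile_law.
Context {R : realType} (mu : probability R R).
Local Notation U := (uniform_prob (@ltr01 R)).

Lemma quantile_nondecreasing (s t : R) : 0 < s -> s <= t -> t < 1 ->
  quantile mu s <= quantile mu t.
Proof.
move=> s0 st t1.
have t0 : 0 < t := lt_le_trans s0 st.
rewrite quantile_le ?s0 ?(le_lt_trans st)//.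
apply: (@le_trans _ _ t%:E); first by rewrite lee_fin.
by rewrite -quantile_le ?t0.
Qed.


(** The quantile of a uniform variable exceeds x exactly when the variable exceeds the
    distribution function at x, and open upper rays determine a probability. *)
Lemma quantile_law (B : set R) : measurable B ->
  U (quantile mu @^-1` B) = mu B.
Proof.
have mQ : measurable_fun [set: measurableTypeR R] (quantile mu).
  exact: measurable_quantile.
move=> mB.
transitivity (pushforward U (quantile mu : measurableTypeR R -> R) B) => //.
pose g (k : nat) : set R := `]- k%:R, +oo[%classic.
have mE : measurable = <<s @RGenOInfty.G R >> := @RGenOInfty.measurableE R.
unshelve refine (@measure_unique _ R R (@RGenOInfty.G R) g mE _ _ _
  (pushforward U (quantile mu : measurableTypeR R -> R)) mu _ _ B mB) => //.
- move=> _ _ [x ->] [y ->]; exists (Num.max x y); apply/seteqP; split => z /=;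
  rewrite !in_itv/= !andbT gt_max.
    by move=> [-> ->].
  by move=> /andP[].
- by move=> k; exists (- k%:R).
- apply/seteqP; split => // x _; exists (Num.truncn `|x|).+1 => //=.
  rewrite /g/= in_itv/= andbT ltrNl (le_lt_trans _ (truncnS_gt _))//.
  by rewrite (le_trans (ler_norm _))// normrN.
- move=> _ [x ->].
  pose c := fine (mu `]-oo, x]%classic).
  have cE : mu `]-oo, x]%classic = c%:E by rewrite fineK// fin_num_measure.
  have c01 : 0 <= c <= 1.
    by rewrite -!lee_fin -cE measure_ge0 probability_le1.
  rewrite -setCitvl; transitivity (1 - c)%:E; last first.
    by rewrite [RHS]probability_setC// cE -EFinB.
  have mS : measurable (quantile mu @^-1` (~` `]-oo, x]%classic)).
    rewrite -[X in measurable X]setTI; apply: mQ => //; exact: measurableC.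
  rewrite -(uniform_prob_itv c01) [RHS]uniform_prob01E//.
  transitivity (lebesgue_measure
    ((quantile mu @^-1` (~` `]-oo, x]%classic)) `&` `]0, 1[%classic)).
    exact: uniform_prob01E.
  congr (lebesgue_measure _); apply/seteqP; split => t /=; rewrite !in_itv/= ?andbT.
    move=> [+ t01]; rewrite t01 => /negP; rewrite quantile_le// cE lee_fin -ltNge.
    by move=> ->.
  move=> [ct t01]; rewrite t01; split => //.
  by apply/negP; rewrite quantile_le// cE lee_fin -ltNge.
- move=> k; have mS : measurable (quantile mu @^-1` g k).
    rewrite -[X in measurable X]setTI; apply: mQ => //; exact: measurable_itv.
  exact: (le_lt_trans (probability_le1 U mS) (ltry _)).
Qed.

Lemma ge0_integral_quantile (f : R -> \bar R) :
  measurable_fun setT f -> (forall x, (0 <= f x)%E) ->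
  (\int[mu]_x f x = \int[U]_t f (quantile mu t))%E.
Proof.
move=> mf f0.
have mQ : measurable_fun [set: measurableTypeR R] (quantile mu).
  exact: measurable_quantile.
transitivity (\int[pushforward U (quantile mu : measurableTypeR R -> R)]_x f x)%E.
  by apply: eq_measure_integral => B mB _; rewrite /= -quantile_law.
by rewrite ge0_integral_pushforward ?preimage_setT.
Qed.

End quantile_law.

(** * Quantiles of a symmetric law *)

Section symmetric_quantile.
Context {R : realType} (mu : probability R R) (m : R).
Implicit Types (t w x y : R).
Hypothesis sym : forall A : set R, measurable A ->
  mu A = mu [set m - x | x in A].

Lemma symmetric_ray x : mu `]-oo, x]%classic = mu `[m - x, +oo[%classic.
Proof.
rewrite sym//; congr (mu _); apply/seteqP; split => y /=.
  by move=> [z]; rewrite !in_itv/= andbT => zx <-; rewrite lerD2l lerN2.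
rewrite in_itv/= andbT => xy; exists (m - y); last by rewrite opprB addrC subrK.
by rewrite in_itv/=; lra.
Qed.

Lemma disjoint_rays x y : x < y ->
  (mu `]-oo, x]%classic + mu `[y, +oo[%classic <= 1)%E.
Proof.
move=> xy; rewrite -measureU//.
  by apply: probability_le1; exact: measurableU.
apply/seteqP; split => // z /=; rewrite !in_itv/= andbT => -[zx yz].
by have := lt_le_trans xy (le_trans yz zx); rewrite ltxx.
Qed.

(** The reflection of the left quantile is the right quantile, which is at least as large. *)
Lemma quantile_reflect_ge t : 0 < t < 1 ->
  quantile mu t <= m - quantile mu (1 - t).
Proof.
move=> t01; have t01' : 0 < 1 - t < 1 by move: t01; lra.
apply/ler_addgt0Pr => e e0; rewrite quantile_le// symmetric_ray.
set y := quantile mu (1 - t).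
rewrite (_ : m - _ = y - e); last by ring.
have Fz : (mu `]-oo, (y - e)%R]%classic < (1 - t)%:E)%E.
  by rewrite ltNge -quantile_le// -ltNge -/y ltrBlDr ltrDl.
have h : (1 - mu `]-oo, (y - e)%R]%classic <= mu `[(y - e)%R, +oo[%classic)%E.
  rewrite -probability_setC// setCitvl; apply: le_measure; rewrite ?inE//.
  by move=> z /=; rewrite !in_itv/= !andbT => /ltW.
apply: le_trans h.
rewrite leeBrDr ?fin_num_measure//.
rewrite (_ : 1%E = (t + (1 - t))%:E); last by rewrite addrC subrK.
by rewrite EFinD leeD2l// ltW.
Qed.

(** The right quantile at t is at most the left quantile at a later t': otherwise two
    disjoint rays would have total mass at least 1 - t + t'. *)
Lemma quantile_reflect_le t t' : 0 < t -> t < t' -> t' < 1 ->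
  m - quantile mu (1 - t) <= quantile mu t'.
Proof.
move=> t0 tt' t1.
rewrite leNgt; apply/negP => H.
have := disjoint_rays H.
rewrite leNgt => /negP; apply.
have h1 : (t'%:E <= mu `]-oo, quantile mu t']%classic)%E.
  by rewrite -quantile_le//; lra.
have h2 : ((1 - t)%:E <= mu `[(m - quantile mu (1 - t))%R, +oo[%classic)%E.
  by rewrite -symmetric_ray -quantile_le//; lra.
apply: lt_le_trans (leeD h1 h2).
by rewrite -EFinD lte_fin; lra.
Qed.

(** Otherwise a ray and its reflection would be disjoint, each of mass above 1/2. *)
Lemma quantile_upper_ge t : 2^-1 < t < 1 -> m / 2 <= quantile mu t.
Proof.
move=> /andP[t2 t1]; rewrite leNgt; apply/negP => H.
have H' : quantile mu t < m - quantile mu t by lra.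
have := disjoint_rays H'.
rewrite leNgt => /negP; apply; rewrite -symmetric_ray.
have h : (t%:E <= mu `]-oo, quantile mu t]%classic)%E.
  by rewrite -quantile_le//; lra.
by apply: lt_le_trans (leeD h h); rewrite -EFinD lte_fin; lra.
Qed.

(** Quantile function of the distance to the centre m / 2, for a law symmetric about it. *)
Definition half_quantile w := quantile mu ((1 + w) / 2) - m / 2.

Lemma half_quantile_ge0 w : 0 < w < 1 -> 0 <= half_quantile w.
Proof. by move=> w01; rewrite subr_ge0 quantile_upper_ge//; lra. Qed.

Lemma half_quantile_nondecreasing w w' : 0 < w -> w <= w' -> w' < 1 ->
  half_quantile w <= half_quantile w'.
Proof. by move=> *; rewrite lerD2r quantile_nondecreasing//; lra. Qed.

(** Left and right quantiles differ only at jumps. For a fixed rational r, two parameters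
    cannot both have r in their jump, by quantile_reflect_le. *)
Lemma countable_quantile_asymmetry : countable
  [set w | 0 < w < 1 /\ quantile mu ((1 - w) / 2) != m / 2 - half_quantile w].
Proof.
(* the parameters at which r separates the left and right quantiles *)
pose C (r : rat) := [set w : R | 0 < w < 1 /\
  quantile mu ((1 + w) / 2) < ratr r < m - quantile mu ((1 - w) / 2)].
apply: (@sub_countable _ _ _ (\bigcup_(r in setT) C r)); last first.
  apply: bigcup_countable => // r _.
  have Csub w w' : C r w -> C r w' -> w <= w'.
    move=> [w01 /andP[w1 w2]] [w'01 /andP[w'1 w'2]]; rewrite leNgt; apply/negP => ww'.
    have := @quantile_reflect_le ((1 + w') / 2) ((1 + w) / 2).
    rewrite (_ : 1 - (1 + w') / 2 = (1 - w') / 2); last by field.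
    move=> h; have {}h : m - quantile mu ((1 - w') / 2) <= quantile mu ((1 + w) / 2).
      by apply: h; lra.
    by have := lt_trans (lt_le_trans w'2 h) w1; rewrite ltxx.
  have [[w Cw]|C0] := pselect (C r !=set0); last first.
    have -> : C r = set0 by apply/seteqP; split => // w Cw; apply: C0; exists w.
    exact: countable0.
  apply: (@sub_countable _ _ _ [set w]).
    apply: subset_card_le => w' Cw'; apply: le_anti.
    by rewrite !Csub.
  exact: finite_set_countable.
apply: subset_card_le => w [w01 /eqP ne].
have : quantile mu ((1 + w) / 2) < m - quantile mu ((1 - w) / 2).
  rewrite lt_neqAle; apply/andP; split.
    by apply/eqP => E; apply: ne; rewrite /half_quantile E; field.
  have := @quantile_reflect_ge ((1 + w) / 2).
  by rewrite (_ : 1 - (1 + w) / 2 = (1 - w) / 2); [apply; lra|field].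
by move=> /rat_in_itvoo[r hr]; exists r.
Qed.

End symmetric_quantile.

(** * Integrals against the diamond transport *)

Section symmetric_law.
Context {R : realType}.
Local Notation U := (uniform_prob (@ltr01 R)).
Implicit Types (f G : R -> R) (w : R).

Lemma integral_uniform_fold_real G :
  measurable_fun setT G -> (forall w, 0 <= G w) ->
  (\int[U]_w (G w)%:E =
   \int[U]_w ((G ((1 - w) / 2) + G ((1 + w) / 2)) / 2)%:E)%E.
Proof.
move=> mG G0.
have mGE : measurable_fun setT (EFin \o G) by exact/measurable_EFinP.
have mGl : measurable_fun [set: measurableTypeR R] (fun w => G ((1 - w) / 2)).
  by apply: (measurableT_comp mG); apply: measurable_funM => //; exact: measurable_funB.
have mGr : measurable_fun [set: measurableTypeR R] (fun w => G ((1 + w) / 2)).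
  by apply: (measurableT_comp mG); apply: measurable_funM => //; exact: measurable_funD.
have mGlE : measurable_fun [set: measurableTypeR R] (fun w => (G ((1 - w) / 2))%:E).
  exact/measurable_EFinP.
have mGrE : measurable_fun [set: measurableTypeR R] (fun w => (G ((1 + w) / 2))%:E).
  exact/measurable_EFinP.
transitivity ((2^-1)%:E * (\int[U]_w (G ((1 - w) / 2))%:E
    + \int[U]_w (G ((1 + w) / 2))%:E))%E; last first.
  rewrite -ge0_integralD//=; first rewrite -ge0_integralZl//=.
  - by apply: eq_integral => w _; rewrite -EFinD -EFinM mulrC.
  - exact: emeasurable_funD.
  - by move=> w _; rewrite adde_ge0// lee_fin.
  - by move=> w _; rewrite lee_fin.
  - by move=> w _; rewrite lee_fin.
have := integral_uniform_fold mGE (fun w => G0 w : (0 <= (G w)%:E)%E).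
rewrite /= => <-.
by rewrite muleA -EFinM mulVf// mul1e.
Qed.

Lemma measurable_half_quantile (mu : probability R R) m :
  measurable_fun [set: measurableTypeR R] (half_quantile mu m).
Proof.
apply: measurable_funB => //; apply: (measurableT_comp (measurable_quantile mu)).
by apply: measurable_funM => //; exact: measurable_funD.
Qed.

Lemma ge0_ae_eq_integral_real f G : 
  measurable_fun [set: measurableTypeR R] f -> measurable_fun [set: measurableTypeR R] G ->
  (forall w, 0 <= f w) -> (forall w, 0 <= G w) ->
  {ae U, forall w, f w = G w} ->
  (\int[U]_w (f w)%:E = \int[U]_w (G w)%:E)%E.
Proof.
move=> mf mG f0 G0 fG; apply: ge0_ae_eq_integral => //.
- exact/measurable_EFinP.
- exact/measurable_EFinP.
- by move=> w _; rewrite lee_fin.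
- by move=> w _; rewrite lee_fin.
case: fG => N [mN N0 fGN]; exists N; split => // w /= ne; apply: fGN => /= E.
by apply: ne => _; rewrite E.
Qed.

(** A symmetric law is that of the centre plus a fair random sign times the half quantile. *)
Lemma symmetric_prob_integral (mu : probability R R) m f :
  (forall A : set R, measurable A -> mu A = mu [set m - x | x in A]) ->
  measurable_fun setT f -> (forall x, 0 <= f x) ->
  (\int[mu]_x (f x)%:E = \int[U]_w
    ((f (m / 2 - half_quantile mu m w) + f (m / 2 + half_quantile mu m w)) / 2)%:E)%E.
Proof.
move=> sym mf f0.
have mh := measurable_half_quantile mu m.
have mQ : measurable_fun [set: measurableTypeR R] (quantile mu).
  exact: measurable_quantile.
have mfQ := measurableT_comp mf mQ.
rewrite ge0_integral_quantile//; last exact/measurable_EFinP.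
rewrite (@integral_uniform_fold_real (f \o quantile mu))//=.
apply: ge0_ae_eq_integral_real.
- apply: measurable_funM => //; apply: measurable_funD;
    apply: (measurableT_comp mfQ); apply: measurable_funM => //.
    exact: measurable_funB.
  exact: measurable_funD.
- apply: measurable_funM => //; apply: measurable_funD; apply: (measurableT_comp mf).
    exact: measurable_funB.
  exact: measurable_funD.
- by move=> w; rewrite mulr_ge0// addr_ge0 /=.
- by move=> w; rewrite mulr_ge0// addr_ge0.
apply: (ae_uniform (countable_quantile_asymmetry sym)) => w w01 /= nC.
congr ((f _ + f _) / 2).
  by apply: contrapT => ne; apply: nC; split => //; apply/eqP.
by rewrite /half_quantile [RHS]addrC subrK.
Qed.

(** Folding the parameter twice maps the four sides of the diamond to the four choices
    of signs; w parametrizes the distance of the first coordinate to 1/2, and 1 - w that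
    of the second one. *)
Lemma diamond_curve_quarters (w : R) : 0 < w < 1 ->
  [/\ diamond_curve ((1 - (1 + w) / 2) / 2) = ((1 - w) / 2, (1 + (1 - w)) / 2),
      diamond_curve ((1 - (1 - w) / 2) / 2) = ((1 + w) / 2, (1 + (1 - w)) / 2),
      diamond_curve ((1 + (1 - w) / 2) / 2) = ((1 + w) / 2, (1 - (1 - w)) / 2) &
      diamond_curve ((1 + (1 + w) / 2) / 2) = ((1 - w) / 2, (1 - (1 - w)) / 2)].
Proof.
move=> /andP[w0 w1]; rewrite /diamond_curve; split; congr pair.
- rewrite ler0_norm; lra.
- by rewrite (@ler0_norm _ (_ - 4^-1)) ?ler0_norm; lra.
- rewrite ler0_norm; lra.
- by rewrite (@ger0_norm _ (_ - 4^-1)) ?ler0_norm; lra.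
- rewrite ger0_norm; lra.
- by rewrite (@ger0_norm _ (_ - 4^-1)) ?ler0_norm; lra.
- rewrite ger0_norm; lra.
- by rewrite (@ger0_norm _ (_ - 4^-1)) ?ger0_norm; lra.
Qed.

End symmetric_law.

Section diamond_integral.
Context {R : realType} (mu nu : probability R R) (m n : R).
Local Notation U := (uniform_prob (@ltr01 R)).
Hypothesis symmu : forall A : set R, measurable A ->
  mu A = mu [set m - x | x in A].
Hypothesis symnu : forall A : set R, measurable A ->
  nu A = nu [set n - x | x in A].
Local Notation A := (half_quantile mu m).
Local Notation B := (half_quantile nu n).

(** Under the diamond transport, the two coordinates have independent fair signs about
    their centres, while the distances to the centres are the half quantiles at w and
    at 1 - w for the same uniform w, hence countermonotone. *)
Lemma diamond_integral (f : R -> R -> R) :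
  measurable_fun setT (fun p : R * R => f p.1 p.2) -> (forall x y, 0 <= f x y) ->
  (\int[diamond_transport mu nu]_z (f z.1 z.2)%:E =
   \int[U]_w ((f (m / 2 - A w) (n / 2 - B (1 - w)%R)
              + f (m / 2 - A w) (n / 2 + B (1 - w)%R)
              + f (m / 2 + A w) (n / 2 - B (1 - w)%R)
              + f (m / 2 + A w) (n / 2 + B (1 - w)%R)) / 4)%:E)%E.
Proof.
move=> mf f0.
have mfE : measurable_fun setT (fun p : R * R => (f p.1 p.2)%:E).
  exact/measurable_EFinP.
have mq := measurable_quantile_pair mu nu.
pose H (s : measurableTypeR R) :=
  let z := quantile_pair mu nu (diamond_curve s) in f z.1 z.2.
have mH : measurable_fun setT H.
  apply: (measurableT_comp mf); apply: (measurableT_comp mq).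
  exact: measurable_diamond_curve.
have H0 s : 0 <= H s by exact: f0.
have -> : (\int[diamond_transport mu nu]_z (f z.1 z.2)%:E = \int[U]_s (H s)%:E)%E.
  rewrite ge0_integral_distribution//; last by move=> p; rewrite lee_fin.
  rewrite ge0_integral_distribution//; first exact: (measurableT_comp mfE mq).
  by move=> p; rewrite lee_fin; exact: f0.
(* the first fold separates the upper half of the diamond from the lower one, the
   second its left side from its right side *)
rewrite integral_uniform_fold_real//.
have m1 : measurable_fun [set: measurableTypeR R] (fun w => (1 - w) / 2 : R).
  by apply: measurable_funM => //; exact: measurable_funB.
have m2 : measurable_fun [set: measurableTypeR R] (fun w => (1 + w) / 2 : R).
  by apply: measurable_funM => //; exact: measurable_funD.
have mH2 : measurable_fun [set: measurableTypeR R]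
    (fun w => (H ((1 - w) / 2) + H ((1 + w) / 2)) / 2).
  apply: measurable_funM => //; apply: measurable_funD.
    exact: (measurableT_comp mH m1).
  exact: (measurableT_comp mH m2).
rewrite integral_uniform_fold_real//; last by move=> w; rewrite mulr_ge0// addr_ge0.
have mA := measurable_half_quantile mu m.
have mB : measurable_fun [set: measurableTypeR R] (fun w => B (1 - w)).
  by apply: (measurableT_comp (measurable_half_quantile nu n)); exact: measurable_funB.
apply: ge0_ae_eq_integral_real.
- apply: measurable_funM => //; apply: measurable_funD.
    exact: (measurableT_comp mH2 m1).
  exact: (measurableT_comp mH2 m2).
- apply: measurable_funM => //.
  apply: measurable_funD; last by apply: (measurableT_comp2 mf); exact: measurable_funD.
  apply: measurable_funD; last first.
    by apply: (measurableT_comp2 mf); [exact: measurable_funD|exact: measurable_funB].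
  apply: measurable_funD; last first.
    by apply: (measurableT_comp2 mf); [exact: measurable_funB|exact: measurable_funD].
  by apply: (measurableT_comp2 mf); exact: measurable_funB.
- by move=> w; rewrite mulr_ge0// addr_ge0// mulr_ge0// addr_ge0.
- by move=> w; rewrite mulr_ge0// !addr_ge0.
(* the parameters at which a quantile jumps; the second coordinate is read at 1 - w *)
pose CB := [set w | 0 < w < 1 /\ quantile nu ((1 - w) / 2) != n / 2 - B w].
pose CA := [set w | 0 < w < 1 /\ quantile mu ((1 - w) / 2) != m / 2 - A w].
have cC : countable (CA `|` [set 1 - w | w in CB]).
  have cB : countable [set 1 - w | w in CB].
    apply: sub_countable (card_image_le _ _) _.
    exact: countable_quantile_asymmetry.
  rewrite -bigcup2E; apply: bigcup_countable => // -[|[|k]] _ //=.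
  exact: countable_quantile_asymmetry.
apply: (ae_uniform cC) => w w01 /not_orP[nA nB].
have EA : quantile mu ((1 - w) / 2) = m / 2 - A w.
  by apply: contrapT => ne; apply: nA; split => //; apply/eqP.
have EB : quantile nu ((1 - (1 - w)) / 2) = n / 2 - B (1 - w).
  apply: contrapT => ne; apply: nB; exists (1 - w); last by rewrite opprB addrC subrK.
  by split; [lra|apply/eqP].
have EA' : quantile mu ((1 + w) / 2) = m / 2 + A w.
  by rewrite /half_quantile [RHS]addrC subrK.
have EB' : quantile nu ((1 + (1 - w)) / 2) = n / 2 + B (1 - w).
  by rewrite /half_quantile [RHS]addrC subrK.
have [E1 E2 E3 E4] := diamond_curve_quarters w01.
rewrite /H E1 E2 E3 E4 /= EA EB EA' EB'.
by field.
Qed.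

Lemma diamond_transport_coupling : coupling mu nu (diamond_transport mu nu).
Proof.
split => C mC.
  transitivity (\int[diamond_transport mu nu]_z (\1_C z.1)%:E)%E.
    rewrite (_ : (fun z => (\1_C z.1)%:E) = EFin \o \1_(C `*` setT)); last first.
      apply/funext => z /=; congr EFin; rewrite !indicE; congr (nat_of_bool _)%:R.
      by apply/idP/idP => /set_mem h; apply/mem_set => //; case: h.
    by rewrite integral_indic ?setIT//; exact: measurableX.
  rewrite (@diamond_integral (fun x _ => \1_C x))//; last first.
    exact: (measurableT_comp (measurable_indic mC)).
  transitivity (\int[mu]_x (\1_C x)%:E)%E; last by rewrite integral_indic// setIT.
  rewrite (symmetric_prob_integral symmu)//.
  by apply: eq_integral => w _; congr EFin; field.
transitivity (\int[diamond_transport mu nu]_z (\1_C z.2)%:E)%E.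
  rewrite (_ : (fun z => (\1_C z.2)%:E) = EFin \o \1_(setT `*` C)); last first.
    apply/funext => z /=; congr EFin; rewrite !indicE; congr (nat_of_bool _)%:R.
    by apply/idP/idP => /set_mem h; apply/mem_set => //; case: h.
  by rewrite integral_indic ?setIT//; exact: measurableX.
rewrite (@diamond_integral (fun _ y => \1_C y))//; last first.
  exact: (measurableT_comp (measurable_indic mC)).
transitivity (\int[nu]_x (\1_C x)%:E)%E; last by rewrite integral_indic// setIT.
rewrite (symmetric_prob_integral symnu)//.
pose g w := (\1_C (n / 2 - B w) + \1_C (n / 2 + B w)) / 2 : R.
have mg : measurable_fun [set: measurableTypeR R] (fun w => (g w)%:E).
  have mB := measurable_half_quantile nu n.
  apply/measurable_EFinP/measurable_funM => //; apply: measurable_funD.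
    by apply: (measurableT_comp (measurable_indic mC)); exact: measurable_funB.
  by apply: (measurableT_comp (measurable_indic mC)); exact: measurable_funD.
rewrite -(integral_uniform_flip mg).
  by apply: eq_integral => w _; congr EFin; rewrite /g; field.
by move=> w; rewrite lee_fin mulr_ge0// addr_ge0.
Qed.

End diamond_integral.

(** * Centred marginals *)

Section transfer.
Context {R : realType}.

Lemma has_integral_image d1 d2 (T1 : measurableType d1) (T2 : measurableType d2)
    (m1 : {measure set T1 -> \bar R}) (m2 : {measure set T2 -> \bar R})
    (phi : T1 -> T2) (f : T2 -> R) v :
  measurable_fun setT phi ->
  (forall B, measurable B -> m1 (phi @^-1` B) = m2 B) ->
  has_integral m2 f v -> has_integral m1 (f \o phi) v.
Proof.
move=> mphi m12 [fi fv].
have [mf fab] := integrableP _ _ _ fi.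
have E (g : T2 -> \bar R) : (\int[pushforward m1 phi]_y g y = \int[m2]_y g y)%E.
  by apply: eq_measure_integral => B mB _; exact: m12.
have fphii : m1.-integrable setT (EFin \o (f \o phi)).
  apply/integrableP; split; first exact: (measurableT_comp mf mphi).
  have := @ge0_integral_pushforward _ _ _ _ _ _ mphi m1 setT
    (fun y => `|(f y)%:E|%E) measurableT.
  rewrite E preimage_setT => <- //; exact: measurableT_comp.
split => //.
have := @integral_pushforward _ _ _ _ _ _ mphi m1 setT (EFin \o f) mf.
by rewrite E preimage_setT fv => ->.
Qed.

End transfer.

Section moments.
Context {R : realType}.
Implicit Types (mu nu : probability R R) (q delta m : R).

(** The exponent q is at most 2 + delta, and recentring costs a constant factor. *)
Lemma moment_center mu q delta a : 1 <= q <= 2 -> 0 < delta ->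
  finite_abs_moment mu (2 + delta) ->
  exists v, has_integral mu (fun x => `|x - a| `^ q) v.
Proof.
move=> q12 d0 fm.
have [w Hw] : exists w, has_integral mu (fun x => `|x| `^ (2 + delta)) w.
  exists (fine (\int[mu]_x (`|x| `^ (2 + delta))%:E)%E); apply: ge0_has_integral.
  - exact: measurable_norm_powR.
  - by move=> x; exact: powR_ge0.
  - by rewrite fineK// ge0_fin_numE// integral_ge0// => x _; rewrite lee_fin powR_ge0.
have one := has_integral_one mu.
have H := has_integralZ 2
  (has_integralD (has_integralD one Hw) (has_integralZ (`|a| `^ q) one)).
apply: (has_integral_dominated _ H).
  apply: (measurableT_comp (measurable_norm_powR q)); exact: measurable_funB.
move=> x; rewrite ger0_norm ?powR_ge0// mulr1.
apply: (le_trans (norm_powRB_le x a q12)); rewrite ler_wpM2l// lerD2r.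
have [x1|x1] := leP `|x| 1.
  rewrite (@le_trans _ _ 1)//; last by rewrite lerDl powR_ge0.
  have h1 : 1 `^ q = 1 :> R by rewrite powR1.
  by rewrite -[leRHS]h1; apply: ge0_ler_powR; rewrite ?nnegrE//; lra.
apply: (@le_trans _ _ (`|x| `^ (2 + delta))); last by rewrite lerDr.
by apply: ler_powR; [exact: ltW|lra].
Qed.

(** Reflection about the centre preserves the law and changes the sign of the integrand. *)
Lemma odd_kernel_symmetric_mean mu q m v x : 1 <= q <= 2 ->
  (forall A : set R, measurable A -> mu A = mu [set m - x | x in A]) ->
  has_integral mu (fun y => `|y - m / 2| `^ q) v ->
  has_integral mu (fun y => odd_kernel q x (y - m / 2)) 0.
Proof.
move=> q12 sym Hv.
have one := has_integral_one mu.
have [||w Hw] := has_integral_dominated (f := fun y : R => odd_kernel q x (y - m / 2)) _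
    (has_integralZ 2 (has_integralD (has_integralZ (`|x| `^ q) one) Hv)).
- apply: (measurableT_comp2 (measurable_odd_kernel q)) => //.
  exact: measurable_funB.
- by move=> y; rewrite mulr1; exact: odd_kernel_le.
have mphi : measurable_fun setT (fun y : R => m - y) by exact: measurable_funB.
have reflect (B : set R) : measurable B -> mu ((fun y => m - y) @^-1` B) = mu B.
  move=> mB; rewrite [RHS]sym//; congr (mu _); apply/seteqP; split => y /=.
    by move=> By; exists (m - y) => //; rewrite opprB addrC subrK.
  by move=> [z Bz <-]; rewrite opprB addrC subrK.
have H1 := has_integral_image mphi reflect Hw.
have H2 : has_integral mu (fun y => odd_kernel q x (y - m / 2)) (-1 * w).
  have := has_integralZ (-1) H1; apply: eq_has_integral => y /=.
  rewrite (_ : m - y - m / 2 = - (y - m / 2)); last by field.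
  by rewrite /odd_kernel opprK; field.
have := has_integral_uniq Hw H2 => E.
have w0 : w = 0 by lra.
by rewrite w0 in Hw.
Qed.

End moments.

(** * Optimality *)

Section optimality.
Context {R : realType} (mu nu : probability R R) (m n q : R).
Local Notation U := (uniform_prob (@ltr01 R)).
Hypothesis symmu : forall A : set R, measurable A ->
  mu A = mu [set m - x | x in A].
Hypothesis symnu : forall A : set R, measurable A ->
  nu A = nu [set n - x | x in A].
Hypothesis q12 : 1 <= q <= 2.
Local Notation A := (half_quantile mu m).
Local Notation B := (half_quantile nu n).
Local Notation X := (fun z : R * R => z.1 - m / 2).
Local Notation Y := (fun z : R * R => z.2 - n / 2).

Lemma uniform_flip_tails (f : R -> R) s :
  measurable_fun [set: measurableTypeR R] f ->
  U [set w | s < f (1 - w)] = U [set w | s < f w].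
Proof.
move=> mf.
have mfl : measurable_fun [set: measurableTypeR R] (fun w => f (1 - w)).
  by apply: (measurableT_comp mf); exact: measurable_funB.
have mi : measurable_fun [set: measurableTypeR R]
    (fun w => (\1_[set w | (s < f w)%R] w : R)%:E).
  apply/measurable_EFinP/measurable_indic; exact: measurable_superlevel.
apply: etrans (esym (integral_superlevel U s mfl)) _.
apply: etrans (integral_superlevel U s mf).
apply: etrans (integral_uniform_flip mi _); last by move=> w; rewrite lee_fin.
by apply: eq_integral => w _; rewrite !indic_superlevel.
Qed.

(** The distance to the centre has the law of the half quantile. *)
Lemma half_quantile_tails (rho : probability R R) (c : R) (f : R -> R) s :
  (forall A : set R, measurable A -> rho A = rho [set c - x | x in A]) ->
  measurable_fun setT f -> (forall x, f (- x) = f x) ->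
  U [set w | s < f (half_quantile rho c w)] =
  rho [set x | s < f (x - c / 2)].
Proof.
move=> sym mf even.
have mh := measurable_half_quantile rho c.
have mfh := measurableT_comp mf mh.
have mfc : measurable_fun setT (fun x : R => f (x - c / 2)).
  by apply: (measurableT_comp mf); exact: measurable_funB.
apply: etrans (esym (integral_superlevel U s mfh)) _.
apply: etrans (integral_superlevel rho s mfc).
rewrite (symmetric_prob_integral sym)//; last first.
  exact/measurable_indic/measurable_superlevel.
apply: eq_integral => w _; congr EFin.
rewrite !indic_superlevel (_ : _ - half_quantile rho c w - _ = - half_quantile rho c w); last by ring.
rewrite (_ : _ + half_quantile rho c w - _ = half_quantile rho c w); last by ring.
by rewrite even; field.
Qed.

(** For fixed a and b the two factors are nondecreasing functions of |X| and |Y|, and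
    the distances A w and B (1 - w) realize the countermonotone coupling of |X| and |Y|. *)
Lemma antimonotone_minimal (pi : probability (R * R)%type R) (a b : R) :
  coupling mu nu pi ->
  (\int[U]_w (even_kernel q (A w) a * even_kernel q (B (1 - w)%R) b)%:E <=
   \int[pi]_z (even_kernel q (X z) a * even_kernel q (Y z) b)%:E)%E.
Proof.
move=> [pi1 pi2].
have mk c : measurable_fun setT (fun x => even_kernel q x c).
  by apply: (measurableT_comp2 (measurable_even_kernel q)).
have mX : measurable_fun setT X by exact: measurable_funB.
have mY : measurable_fun setT Y by exact: measurable_funB.
have mA := measurable_half_quantile mu m.
have mB' := measurable_half_quantile nu n.
have mB : measurable_fun [set: measurableTypeR R] (fun w => B (1 - w)).
  by apply: (measurableT_comp mB'); exact: measurable_funB.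
apply: (@countermonotone_minimal _ _ _ _ _ U pi _ _ _ _ `]0, 1[%classic).
- exact: (measurableT_comp (mk a) mA).
- exact: (measurableT_comp (mk b) mB).
- exact: (measurableT_comp (mk a) mX).
- exact: (measurableT_comp (mk b) mY).
- by move=> w; exact: even_kernel_ge0.
- by move=> w; exact: even_kernel_ge0.
- by move=> w; exact: even_kernel_ge0.
- by move=> w; exact: even_kernel_ge0.
- by [].
- have mI : measurable (`]0, 1[%classic : set R) by exact: measurable_itv.
  apply: etrans (uniform_prob01E mI) _.
  by rewrite setIid lebesgue_measure_itv/= lte_fin ltr01 sube0.
- suff anti w w' : 0 < w -> w <= w' -> w' < 1 ->
      even_kernel q (A w) a <= even_kernel q (A w') a /\
      even_kernel q (B (1 - w')) b <= even_kernel q (B (1 - w)) b.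
    move=> w w'; rewrite /= !in_itv/= => /andP[w0 w1] /andP[w'0 w'1].
    case: (leP w w') => [ww'|/ltW ww'].
      have [h1 h2] := anti _ _ w0 ww' w'1.
      by rewrite mulr_le0_ge0// ?subr_le0 ?subr_ge0.
    have [h1 h2] := anti _ _ w'0 ww' w1.
    by rewrite mulr_ge0_le0// ?subr_le0 ?subr_ge0.
  move=> w0 ww' w'1; have /andP[q1 _] := q12.
  split; apply: even_kernel_nondecreasing => //.
  + by apply: (half_quantile_ge0 symmu); lra.
  + exact: half_quantile_nondecreasing.
  + by apply: (half_quantile_ge0 symnu); lra.
  + by apply: half_quantile_nondecreasing; lra.
- move=> s; apply: etrans (half_quantile_tails s symmu (mk a)
    (fun x => even_kernelN q x a)) _.
  rewrite -pi1; last first.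
    apply: (@measurable_superlevel R _ R (fun x => even_kernel q (x - m / 2) a)).
    by apply: (measurableT_comp (mk a)); exact: measurable_funB.
  by congr (pi _); apply/seteqP; split => z /=; [case|].
- move=> s.
  apply: etrans (uniform_flip_tails s (measurableT_comp (mk b) mB')) _.
  apply: etrans (half_quantile_tails s symnu (mk b)
    (fun x => even_kernelN q x b)) _.
  rewrite -pi2; last first.
    apply: (@measurable_superlevel R _ R (fun x => even_kernel q (x - n / 2) b)).
    by apply: (measurableT_comp (mk b)); exact: measurable_funB.
  by congr (pi _); apply/seteqP; split => z /=; [case|].
Qed.

Let diamond_kernel (w : measurableTypeR R) (z : R * R) : R :=
  even_kernel q (A w) (X z) * even_kernel q (B (1 - w)%R) (Y z).

Let measurable_diamond_kernel :
  measurable_fun setT (fun p : measurableTypeR R * (R * R) => diamond_kernel p.1 p.2).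
Proof.
have mA := measurable_half_quantile mu m.
have mB : measurable_fun [set: measurableTypeR R] (fun w => B (1 - w)).
  by apply: (measurableT_comp (measurable_half_quantile nu n)); exact: measurable_funB.
apply: measurable_funM; apply: (measurableT_comp2 (measurable_even_kernel q)).
- exact: (measurableT_comp mA).
- by apply: measurable_funB => //; exact: measurableT_comp.
- exact: (measurableT_comp mB).
- by apply: measurable_funB => //; exact: measurableT_comp.
Qed.

Let diamond_kernel_ge0 w z : 0 <= diamond_kernel w z.
Proof. by rewrite mulr_ge0 ?even_kernel_ge0. Qed.

(** Averaging the cost over the independent signs of one of the two points leaves
    the product of the even kernels. *)
Lemma quadratic_cost_diamond : quadratic_cost q (diamond_transport mu nu) =
  (\int[U]_w \int[U]_w' (even_kernel q (A w') (A w)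
     * even_kernel q (B (1 - w')%R) (B (1 - w)%R))%:E)%E.
Proof.
transitivity (\int[diamond_transport mu nu]_z \int[U]_w (diamond_kernel w z)%:E)%E.
  apply: eq_integral => z _.
  rewrite (diamond_integral symmu symnu (f := fun x y => pair_cost q x y z.1 z.2)).
  - apply: eq_integral => w _; congr EFin.
    rewrite /pair_cost /diamond_kernel /even_kernel !normrM !powRM//.
    rewrite (_ : m / 2 - A w - z.1 = - (A w + (z.1 - m / 2))); last by ring.
    rewrite (_ : m / 2 + A w - z.1 = A w - (z.1 - m / 2)); last by ring.
    rewrite (_ : n / 2 - B (1 - w) - z.2 = - (B (1 - w) + (z.2 - n / 2))); last by ring.
    rewrite (_ : n / 2 + B (1 - w) - z.2 = B (1 - w) - (z.2 - n / 2)); last by ring.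
    by rewrite !normrN; field.
  - apply: (measurableT_comp (measurable_norm_powR q)).
    by apply: measurable_funM; exact: measurable_funB.
  - by move=> x y; exact: powR_ge0.
rewrite (@fubini_tonelli _ _ _ _ _ (diamond_transport mu nu) U
  (fun p => (diamond_kernel p.2 p.1)%:E)).
- apply: eq_integral => w _.
  rewrite (diamond_integral symmu symnu (f := fun x y => diamond_kernel w (x, y))).
  + apply: eq_integral => w' _; congr EFin.
    rewrite /diamond_kernel/=.
    rewrite (_ : m / 2 - A w' - m / 2 = - A w'); last by ring.
    rewrite (_ : m / 2 + A w' - m / 2 = A w'); last by ring.
    rewrite (_ : n / 2 - B (1 - w') - n / 2 = - B (1 - w')); last by ring.
    rewrite (_ : n / 2 + B (1 - w') - n / 2 = B (1 - w')); last by ring.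
    rewrite !(even_kernelC q (A w)) !(even_kernelC q (B (1 - w))) !even_kernelN.
    by field.
  + apply: (measurableT_comp2 measurable_diamond_kernel) => //.
    exact: measurable_fun_pair.
  + by move=> x y; exact: diamond_kernel_ge0.
- apply/measurable_EFinP.
  by apply: (measurableT_comp2 measurable_diamond_kernel).
- by move=> p; rewrite lee_fin.
Qed.

(** The integral of the even kernels is bilinear in the pair of laws, so the
    diamond transport can replace pi in one argument at a time. *)
Lemma quadratic_cost_diamond_le (pi : probability (R * R)%type R) :
  coupling mu nu pi ->
  (quadratic_cost q (diamond_transport mu nu) <=
   \int[pi]_z' \int[pi]_z (even_kernel q (X z) (X z')
     * even_kernel q (Y z) (Y z'))%:E)%E.
Proof.
move=> cpi; rewrite quadratic_cost_diamond.
have mA := measurable_half_quantile mu m.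
have mB : measurable_fun [set: measurableTypeR R] (fun w => B (1 - w)).
  by apply: (measurableT_comp (measurable_half_quantile nu n)); exact: measurable_funB.
have mdE : measurable_fun setT
    (fun p : measurableTypeR R * (R * R) => (diamond_kernel p.1 p.2)%:E).
  by apply/measurable_EFinP.
apply: (@le_trans _ _ (\int[U]_w \int[pi]_z (diamond_kernel w z)%:E)%E).
  apply: ge0_le_integral => //.
  - by move=> w _; apply: integral_ge0 => w' _; rewrite lee_fin mulr_ge0 ?even_kernel_ge0.
  - apply: (@measurable_fun_fubini_tonelli_F _ _ _ _ _ U
      (fun p : measurableTypeR R * measurableTypeR R =>
        (even_kernel q (A p.2) (A p.1)
         * even_kernel q (B (1 - p.2)) (B (1 - p.1)))%:E)) => //.
      apply/measurable_EFinP; apply: measurable_funM;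
        apply: (measurableT_comp2 (measurable_even_kernel q)).
      + exact: (measurableT_comp mA).
      + exact: (measurableT_comp mA).
      + exact: (measurableT_comp mB).
      + exact: (measurableT_comp mB).
    by move=> p; rewrite lee_fin mulr_ge0 ?even_kernel_ge0.
  - apply: (@measurable_fun_fubini_tonelli_F _ _ _ _ _ pi
      (fun p => (diamond_kernel p.1 p.2)%:E)) => //.
    by move=> p; rewrite lee_fin.
  - move=> w _; apply: (le_trans (antimonotone_minimal (A w) (B (1 - w)) cpi)).
    rewrite le_eqVlt; apply/orP; left; apply/eqP; apply: eq_integral => z _.
    by rewrite /diamond_kernel; congr (_ * _)%:E; exact: even_kernelC.
rewrite (@fubini_tonelli _ _ _ _ _ U pi
  (fun p => (diamond_kernel p.1 p.2)%:E))//; last first.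
  by move=> p; rewrite lee_fin.
apply: ge0_le_integral => //.
- by move=> z _; apply: integral_ge0 => w _; rewrite lee_fin.
- apply: (@measurable_fun_fubini_tonelli_G _ _ _ _ _ U
      (fun p => (diamond_kernel p.1 p.2)%:E)) => //.
  by move=> p; rewrite lee_fin.
- apply: (@measurable_fun_fubini_tonelli_F _ _ _ _ _ pi
    (fun p : (R * R) * (R * R) => (even_kernel q (X p.2) (X p.1)
     * even_kernel q (Y p.2) (Y p.1))%:E)) => //.
    apply/measurable_EFinP; apply: measurable_funM;
      apply: (measurableT_comp2 (measurable_even_kernel q));
      by apply: measurable_funB => //; exact: measurableT_comp.
  by move=> p; rewrite lee_fin mulr_ge0 ?even_kernel_ge0.
- by move=> z _; exact: (antimonotone_minimal (z.1 - m / 2) (z.2 - n / 2) cpi).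
Qed.

End optimality.

Unset Implicit Arguments.

Theorem theorem14 (R : realType) (q : R) (mu nu : probability R R) (delta : R)
    (hq : 1 < q <= 2)
    (smu : symmetric_prob mu) (snu : symmetric_prob nu)
    (hdelta : 0 < delta)
    (mmu : finite_abs_moment mu (2 + delta))
    (mnu : finite_abs_moment nu (2 + delta)) :
  coupling mu nu (diamond_transport mu nu) /\
  forall pi : probability (R * R)%type R, coupling mu nu pi ->
    (quadratic_cost q (diamond_transport mu nu) <= quadratic_cost q pi)%E.
Proof.
have [m symmu] := smu; have [n symnu] := snu.
split; first exact: (diamond_transport_coupling symmu symnu).
move=> pi cpi; have [pi1 pi2] := cpi.
have q12 : 1 <= q <= 2 by move: hq => /andP[/ltW -> ->].
apply: (le_trans (quadratic_cost_diamond_le symmu symnu q12 cpi)).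
have [vr Hr] := moment_center (m / 2) q12 hdelta mmu.
have [vs Hs] := moment_center (n / 2) q12 hdelta mnu.
have fst_pi (B : set R) : measurable B -> pi (fst @^-1` B) = mu B.
  by move=> mB; rewrite -pi1//; congr (pi _); apply/seteqP; split => z /=; [|case].
have snd_pi (B : set R) : measurable B -> pi (snd @^-1` B) = nu B.
  by move=> mB; rewrite -pi2//; congr (pi _); apply/seteqP; split => z /=; [|case].
have mX : measurable_fun setT (fun z : R * R => z.1 - m / 2) by exact: measurable_funB.
have mY : measurable_fun setT (fun z : R * R => z.2 - n / 2) by exact: measurable_funB.
apply: (le_trans (symmetrization_le mX mY q12 (has_integral_image measurable_fst fst_pi Hr)
  (has_integral_image measurable_snd snd_pi Hs)
  (fun x => has_integral_image measurable_fst fst_pi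
    (odd_kernel_symmetric_mean x q12 symmu Hr))
  (fun y => has_integral_image measurable_snd snd_pi
    (odd_kernel_symmetric_mean y q12 symnu Hs)))).
rewrite le_eqVlt; apply/orP; left; apply/eqP.
apply: eq_integral => z' _; apply: eq_integral => z _; congr EFin.
rewrite /pair_cost normrM powRM//.
have shift (a b c : R) : (a - c) - (b - c) = a - b by ring.
by rewrite !shift.
Qed.
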